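(* Let $H$ be an infinite-dimensional separable Hilbert space and let $A\colon H\to H$ be a bounded normal operator. Let $S\subseteq H$ be a finite subset, let $J_x\subseteq \mathbb{N}\cup\{0\}$ $(x\in S)$ be subsets and let $(c_{n,x})_{n\in J_x,\,x\in S}$ be nonzero scalars such that $\{c_{n,x}A^nx\}_{n\in J_x,\,x\in S}$ is a frame for $H$. Assume that there exist $\eta\in\mathbb{N}$ and $\delta>0$ such that for each $x\in S$ with $J_x$ infinite there is an increasing syndetic sequence $(n^x_k)_{k\in\mathbb{N}}\subseteq J_x$ and non-negative integers $(i^x_k)_{k\in\mathbb{N}}$ satisfying $|i^x_k-n^x_k|\le \eta$ and $|c_{n^x_k,x}|\,\|A^{i^x_k}x\|\ge\delta$ for all $k\in\mathbb{N}$. Then there exist a positive integer $N\le |S\setminus \ker(A)|$ and finitely many radii $r_1<r_2<\cdots<r_N$ in $(0,\|A\|]$ such that the following statements hold: (a) The continuous spectrum of $A$ lies entirely on arcs of the circles centered at the origin with radii $r_1,\dots,r_N$ (i.e. it is contained in $\bigcup_{i=1}^N\{z\in\mathbb{C}: |z|=r_i\}$), where the $r_i$ are positive numbers for which $$S_i=\Bigl\{x\in S : \sup_{z\in \mathrm{supp}(Ux)}|z| = r_i\Bigr\}\neq\emptyset .$$ (b) For every sufficiently small $\varepsilon>0$, there are at most finitely many spectral values of $A$ contained in $$\overline{B_{r_1-\varepsilon}}(0)\,\cup\,\bigcup_{i=2}^N\Bigl(\overline{B_{r_i-\varepsilon}}(0)\setminus B_{r_{i-1}+\varepsilon}(0)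\Bigr).$$
   Context: $\mathbb{N}=\{1,2,3,\dots\}$. A countable family $\{x_n\}$ in $H$ is a frame for $H$ if there are constants $B,C>0$ with $B\|x\|^2\le\sum_n|\langle x,x_n\rangle|^2\le C\|x\|^2$ for all $x\in H$. A sequence of integers $(c_n)_{n\in\mathbb{N}}$ is syndetic if $\sup_n|c_{n+1}-c_n|<\infty$. $B_r(0)$ is the open disc in $\mathbb{C}$ of radius $r$ centered at $0$, and $\overline{B_r}(0)$ is its closure. A spectral value of $A$ is an element of the spectrum $\sigma(A)$. The continuous spectrum of $A$ is the set of $\lambda\in\sigma(A)$ such that $A-\lambda I$ is one-to-one with dense range different from $H$. Spectral representation: by the spectral theorem with multiplicity there are mutually singular, compactly supported, finite non-negative Borel measures $\{\mu_j\}_{j\in\mathbb{N}\cup\{\infty\}}$ (some possibly zero) supported in $\sigma(A)$ and a unitary $U\colon H\to V_A=(L^2(\mu_\infty))^{(\infty)}\oplus L^2(\mu_1)\oplus (L^2(\mu_2))^{(2)}\oplus\cdots$ such that $UAU^{-1}$ is multiplication by $z$ in each coordinate. The scalar spectral measure is $\mu=\mu_A=\mu_\infty+\sum_{j\ge1}\mu_j$ (the $\mu_j$ being scaled, as we may, so that the sum is finite). Since the $\mu_j$ are mutually singular, an element $f\in V_A$ is viewed as a vector-valued function on $\mathrm{supp}(\mu)$ defined $\mu$-a.e., and $\mathrm{supp}(f)=\{z: f(z)\ne0\}$, defined up to $\mu$-null sets; $\sup_{z\in\mathrm{supp}(f)}|z|$ is understood as the $\mu$-essential supremum of $|z|$ over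 this set. *)

(* Defs.v *)
From HB Require Import structures.
From mathcomp Require Import all_boot all_order all_algebra finmap.
From mathcomp Require Import sesquilinear.
From mathcomp Require Import all_classical all_reals all_analysis.
From mathcomp Require Import ess_sup_inf.
From mathcomp Require Import complex.

Set Implicit Arguments.
Unset Strict Implicit.
Unset Printing Implicit Defensive.

Import Order.TTheory GRing.Theory Num.Theory Num.Def.
Import numFieldNormedType.Exports.

Local Open Scope classical_set_scope.
Local Open Scope ring_scope.
Local Open Scope complex_scope.

(* Norms on normed spaces over R[i] take their values in R[i]; [rnorm] is the
   same number, read in R. It is used for vectors and for complex scalars. *)
Definition rnorm (R : realType) (V : normedZmodType R[i]) (v : V) : R :=
  complex.Re `|v|.

Section Operators.
Variables (R : realType) (H : completeNormedModType R[i]).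

(* With the completeness of H, this makes (H, ip) a complex Hilbert space. The
   form is linear in its first argument. *)
Definition hilbert_form (ip : {dot H for conjC}) : Prop :=
  forall x : H, ip x x = `|x| ^+ 2.

Definition separable_space : Prop := exists D : set H, countable D /\ dense D.

Definition infinite_dimensional : Prop :=
  ~ exists (n : nat) (e : 'I_n -> H),
      forall x, exists a : 'I_n -> R[i], x = \sum_(i < n) a i *: e i.

Definition bounded_op (A : H -> H) : Prop :=
  exists M : R, forall x, rnorm (A x) <= M * rnorm x.

Definition opnorm (A : H -> H) : R :=
  sup [set rnorm (A x) | x in [set x | rnorm x <= 1]].

Definition adjoint_of (ip : {dot H for conjC}) (A B : H -> H) : Prop :=
  forall x y, ip (A x) y = ip x (B y).

Definition normal_op (ip : {dot H for conjC}) (A : H -> H) : Prop :=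
  exists2 B : H -> H, adjoint_of ip A B & forall x, A (B x) = B (A x).

Definition shift_op (A : H -> H) (l : R[i]) : H -> H := fun x => A x - l *: x.

Definition spectrum (A : H -> H) : set R[i] :=
  [set l | ~ exists B : {linear H -> H},
      [/\ bounded_op B, cancel (shift_op A l) B & cancel B (shift_op A l)]].

Definition continuous_spectrum (A : H -> H) : set R[i] :=
  [set l | [/\ spectrum A l, injective (shift_op A l),
               dense (range (shift_op A l)) &
               range (shift_op A l) <> setT]].

Definition is_frame (I : choiceType) (ip : {dot H for conjC})
    (D : set I) (v : I -> H) : Prop :=
  countable D /\
  exists B C : R, [/\ 0 < B, 0 < C & forall x : H,
    ((B * rnorm x ^+ 2)%:E <= \esum_(i in D) (rnorm (ip x (v i)) ^+ 2)%:E
      <= (C * rnorm x ^+ 2)%:E)%E].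

End Operators.

Definition syndetic (c : nat -> int) : Prop :=
  exists M : int, forall k, `|c k.+1 - c k| <= M.

Section Discs.
Variable R : realType.

Definition disc (rho : R) : set R[i] := [set z | rnorm z < rho].

Definition cdisc (rho : R) : set R[i] := closure (disc rho : set R[i]^o).

End Discs.

(* The complex plane with its Borel sigma-algebra. *)
Notation borelC R := (g_sigma_algebraType (@open R[i]^o)).

Section SpectralRepresentation.
Variable R : realType.

(* Multiplicities: [Some j] stands for the multiplicity j + 1, and [None] for
   the multiplicity infinity. *)
Definition multiplicity : Type := option nat.

Definition copy_index (m : multiplicity) : set nat :=
  if m is Some j then [set k | (k < j.+1)%N] else setT.

Variable mu : multiplicity -> {finite_measure set (borelC R) -> \bar R}.

Definition scalar_measure : {measure set (borelC R) -> \bar R} :=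
  measure_add (mu None) (mseries (fun j => mu (Some j)) 0).

(* For a countable family, mutual singularity is the existence of pairwise
   disjoint Borel sets E m such that mu m is concentrated on E m. *)
Definition carriers (E : multiplicity -> set (borelC R)) : Prop :=
  [/\ forall m, measurable (E m),
      trivIset setT E &
      forall m, mu m (~` E m) = 0%E].

(* Elements of V_A are given by representatives: [f m k] is the component in the
   k-th copy of L^2(mu m), and only indices k in [copy_index m] matter. *)
Definition rep : Type := multiplicity -> nat -> R[i] -> R[i].

Definition coordinates : set (multiplicity * nat) :=
  [set p | copy_index p.1 p.2].

Definition VA_sqnorm (f : rep) : \bar R :=
  (\esum_(p in coordinates)
     \int[mu p.1]_z (rnorm (f p.1 p.2 z) ^+ 2)%:E)%E.

Definition in_VA (f : rep) : Prop :=
  (forall p, coordinates p ->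
     measurable_fun [set: borelC R] (f p.1 p.2 : borelC R -> borelC R)) /\
  (VA_sqnorm f < +oo)%E.

Definition VA_eq (f g : rep) : Prop :=
  forall p, coordinates p ->
    {ae mu p.1, forall z, f p.1 p.2 z = g p.1 p.2 z}.

Definition unitary_onto_VA (H : completeNormedModType R[i]) (U : H -> rep) :
    Prop :=
  [/\ forall x, in_VA (U x),
      forall (a : R[i]) x y,
        VA_eq (U (a *: x + y)) (fun m k z => a * U x m k z + U y m k z),
      forall x, VA_sqnorm (U x) = (rnorm x ^+ 2)%:E &
      forall f, in_VA f -> exists x, VA_eq (U x) f].

Record spectral_representation (H : completeNormedModType R[i]) (A : H -> H)
    (E : multiplicity -> set (borelC R)) (U : H -> rep) : Prop := {
  sr_singular : carriers E;
  sr_compact : forall m, exists2 K : set R[i]^o,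
    compact K & (mu m).-negligible (~` K);
  sr_spectrum : forall m, (mu m).-negligible (~` spectrum A);
  sr_finite : (scalar_measure setT < +oo)%E;
  sr_unitary : unitary_onto_VA U;
  sr_mult : forall x, VA_eq (U (A x)) (fun m k z => z * U x m k z) }.

(* By disjointness of the carriers, at most one block m contributes at each
   point z: the value of f at z is (f m k z)_k when z is in E m. *)
Definition VA_supp (E : multiplicity -> set (borelC R)) (f : rep) :
    set (borelC R) :=
  [set z | exists p, [/\ coordinates p, E p.1 z & f p.1 p.2 z != 0]].

(* Essential supremum over the support: off the support the function is -oo. *)
Definition supp_radius (E : multiplicity -> set (borelC R)) (f : rep) : \bar R :=
  ess_sup scalar_measure
    (patch (fun=> -oo%E) (VA_supp E f) (fun z => (rnorm (z : R[i]))%:E)).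

End SpectralRepresentation.

(* Main.v *)
Require Import Defs.
From HB Require Import structures.
From mathcomp Require Import all_boot all_order all_algebra finmap.
From mathcomp Require Import sesquilinear.
From mathcomp Require Import all_classical all_reals all_analysis.
From mathcomp Require Import measurable_realfun ess_sup_inf.
From mathcomp Require Import complex.
From mathcomp Require Import lra ring.

Set Implicit Arguments.
Unset Strict Implicit.
Unset Printing Implicit Defensive.

Import Order.TTheory GRing.Theory Num.Theory Num.Def.
Import numFieldNormedType.Exports.

Local Open Scope classical_set_scope.
Local Open Scope ring_scope.
Local Open Scope complex_scope.

(** Let [K] be a Borel region of the plane with [|z| <= b] on [K], and let
    [x] in [S] have radius (the essential supremum of [|z|] over the support
    of [U x]) larger than some [a > b].  Part of [x] lives where [|z| > a], so
    [|A^n x| >= k a^n] for some [k > 0]; since the members of a frame are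
    bounded, [|c_(n,x)| = O(a^-n)].  A vector [g] living on [K] satisfies
    [|<g, A^n x>| <= b^n |g| |x|], hence
    [|<g, c_(n,x) A^n x>|^2 <= M q^n |g|^2] with [q = (b/a)^2 < 1].  If
    instead [x] lives off [K], these products vanish, and if [A x = 0] they
    vanish for [n >= 1].

    Suppose that every [x] in [S] falls in one of these three cases, which is
    what happens when the moduli of the points of [K] avoid the radii of the
    vectors [x] with [A x <> 0].  Then all the terms with [n >= n0] together
    contribute less than the lower frame constant for a suitable [n0], and
    finitely many frame vectors already control [|g|] on the space of vectors
    living on [K], which is therefore finite-dimensional
    ([frame_geometric_tail]).  Spectral values interior to [K] carry pairwise
    orthogonal vectors living on small disjoint discs inside [K], so there are
    only finitely many of them ([finite_spectrum_in_gap],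
    [finite_spectrum_in_annulus]).

    The [r_i] are the distinct radii of the [x] in [S] with [A x <> 0]; there is
    at least one, for otherwise the previous argument with the whole plane as
    [K] would make [H] finite-dimensional.  Part (b) is the finiteness just
    described, between two consecutive radii.  For part (a), a spectral value
    off the circles is then isolated in the spectrum; a nonzero vector living
    near it lives at that single point and is an eigenvector, so the point is
    not in the continuous spectrum ([isolated_not_continuous]).

    The representation [U] is given with norms and no inner product, and
    elements of [V_A] are representatives up to null sets.  The spectral
    projections and resolvents are thus obtained by multiplying [U x] by a
    bounded Borel function and pulling back through surjectivity of [U]
    ([U_multiply]), estimates by pointwise domination ([U_dominated]), and
    orthogonality from Pythagoras' identity ([U_disjoint]). *)

(** * Norms and inner products read in the reals *)

Section NormInR.
Variable R : realType.
Implicit Type V : normedZmodType R[i].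

Lemma norm_rnorm V (v : V) : `|v| = (rnorm v)%:C.
Proof. by rewrite /rnorm RRe_real. Qed.

Lemma rnorm_ge0 V (v : V) : 0 <= rnorm v.
Proof. by rewrite -lecR -norm_rnorm normr_ge0. Qed.

Lemma rnorm0 V : rnorm (0 : V) = 0.
Proof. by rewrite /rnorm normr0. Qed.

Lemma rnorm_eq0 V (v : V) : (rnorm v == 0) = (v == 0).
Proof.
apply/eqP/eqP => [v0|->]; last exact: rnorm0.
by apply/eqP; rewrite -normr_eq0 norm_rnorm v0.
Qed.

Lemma rnorm_gt0 V (v : V) : (0 < rnorm v) = (v != 0).
Proof. by rewrite lt_neqAle rnorm_ge0 andbT eq_sym rnorm_eq0. Qed.

Lemma rnormD V (u v : V) : rnorm (u + v) <= rnorm u + rnorm v.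
Proof. by rewrite -lecR rmorphD/= -!norm_rnorm ler_normD. Qed.

Lemma rnormN V (v : V) : rnorm (- v) = rnorm v.
Proof. by rewrite /rnorm normrN. Qed.

Lemma rnormB V (u v : V) : rnorm (u - v) = rnorm (v - u).
Proof. by rewrite -opprB rnormN. Qed.

Lemma ler_rnormB V (u v : V) : rnorm u - rnorm v <= rnorm (u - v).
Proof. by rewrite lerBlDr; have := rnormD (u - v) v; rewrite subrK. Qed.

Lemma rnormM (a b : R[i]) : rnorm (a * b) = rnorm a * rnorm b.
Proof. by apply: complexI; rewrite rmorphM/= -!norm_rnorm normrM. Qed.

Lemma rnorm1 : rnorm (1 : R[i]) = 1.
Proof. by rewrite /rnorm normr1. Qed.

Lemma rnormX (a : R[i]) n : rnorm (a ^+ n) = rnorm a ^+ n.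
Proof. by elim: n => [|n IH]; rewrite ?expr0 ?rnorm1// !exprS rnormM IH. Qed.

Lemma rnormC (r : R) : 0 <= r -> rnorm r%:C = r.
Proof. by move=> r0; rewrite /rnorm ger0_norm ?ler0c. Qed.

Lemma rnormV (a : R[i]) : rnorm a^-1 = (rnorm a)^-1.
Proof. by apply: complexI; rewrite fmorphV/= -!norm_rnorm normfV. Qed.

Lemma rnormZ (W : normedModType R[i]) (a : R[i]) (v : W) :
  rnorm (a *: v) = rnorm a * rnorm v.
Proof. by apply: complexI; rewrite rmorphM/= -!norm_rnorm normrZ. Qed.

End NormInR.

Section InnerProduct.
Variables (R : realType) (H : completeNormedModType R[i]).
Variables (ip : {dot H for conjC}) (Hip : hilbert_form ip).

Lemma CauchySchwarz_rnorm x y : rnorm (ip x y) <= rnorm x * rnorm y.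
Proof.
have [->|y0] := eqVneq y 0; first by rewrite linear0r !rnorm0 mulr0.
have yy0 : ip y y != 0 by rewrite Hip sqrf_eq0 normr_eq0.
pose a := ip x y / ip y y; pose u := x - a *: y.
have uy0 : ip u y = 0.
  by rewrite linearBl linearZl_LR/= /a divfK// subrr.
have uay : ip u (a *: y) = 0 by rewrite linearZr_LR/= uy0 mulr0.
have xE : ip x x = ip u u + ip (a *: y) (a *: y).
  by have := hnormDd uay; rewrite /u subrK.
have : (rnorm (a *: y)) ^+ 2 <= rnorm x ^+ 2.
  by rewrite -lecR !rmorphXn/= -!norm_rnorm -!Hip xE lerDr dnorm_ge0.
rewrite ler_sqr ?nnegrE ?rnorm_ge0// rnormZ /a rnormM rnormV Hip rnormX.
have -> : rnorm `|y| = rnorm y by rewrite norm_rnorm rnormC// rnorm_ge0.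
have ny : 0 < rnorm y by rewrite rnorm_gt0.
rewrite expr2 invfM -!mulrA mulVf ?mulr1 ?gt_eqF//.
by rewrite ler_pdivrMr.
Qed.

(** The identity says that the real part of [conj a . ip x y] is zero for every
    [a]; for [a = ip x y] this reads [|ip x y|^2 = 0]. *)
Lemma pythagoras_orthogonal x y :
  (forall a : R[i], rnorm (x + a *: y) ^+ 2 =
                    rnorm x ^+ 2 + rnorm a ^+ 2 * rnorm y ^+ 2) ->
  ip x y = 0.
Proof.
move=> pyth; pose a := ip x y.
have xE : ip (x + a *: y) (x + a *: y) = ip x x + `|a| ^+ 2 * ip y y.
  by rewrite !Hip !norm_rnorm -!rmorphXn/= -rmorphM/= -rmorphD/= pyth.
have dE : ip x (a *: y) = `|a| ^+ 2.
  by rewrite linearZr_LR/= -/a mulrC -normCK.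
have := dnormD ip x (a *: y); rewrite /= dE => e2.
move: xE; rewrite {}e2 (dnormZ ip) -[RHS]addr0 => /addrI/eqP.
rewrite conj_Creal ?rpredX ?normr_real// -mulr2n mulrn_eq0/=.
by rewrite sqrf_eq0 normr_eq0 => /eqP.
Qed.

End InnerProduct.

(** * Borel functions of a complex variable *)

Section ComplexMeasurability.
Variable R : realType.

Lemma ball_rnorm (z w : R[i]^o) (e : R) :
  ball z (e%:C : R[i]) w <-> rnorm (z - w) < e.
Proof. by rewrite -ball_normE /ball_/= norm_rnorm ltcR. Qed.

Lemma near_rnorm (z : R[i]^o) (e : R) :
  0 < e -> nbhs z [set w : R[i]^o | rnorm (z - w) < e].
Proof.
move=> e0; apply/nbhs_ballP; exists (e%:C); first by rewrite /= -[0]/((0 : R)%:C) ltcR.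
by move=> w /ball_rnorm.
Qed.

Lemma nbhs_rnorm (z : R[i]^o) (O : set R[i]^o) :
  nbhs z O -> exists2 e : R, 0 < e & forall w, rnorm (z - w) < e -> O w.
Proof.
move=> /nbhs_ballP[e /= e0 eG]; have eE : e = (complex.Re e)%:C.
  by rewrite RRe_real// gtr0_real.
exists (complex.Re e); first by rewrite -ltcR -eE.
by move=> w zw; apply: eG; rewrite eE; apply/ball_rnorm.
Qed.

Lemma Re_le_rnorm (z : R[i]) : `|complex.Re z| <= rnorm z.
Proof. by rewrite -lecR -norm_rnorm normc_ge_Re. Qed.

Lemma Im_le_rnorm (z : R[i]) : `|complex.Im z| <= rnorm z.
Proof.
rewrite -normrN -ReiNIm (le_trans (Re_le_rnorm _))// rnormM.
by rewrite /(rnorm 'i) normc_def /= expr0n expr1n add0r sqrtr1 mulr1.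
Qed.

Lemma rnorm_le_ReIm (z : R[i]) : rnorm z <= `|complex.Re z| + `|complex.Im z|.
Proof.
rewrite [z in rnorm z]complexE (le_trans (rnormD _ _))// rnormM.
rewrite {2}/rnorm normc_def /= expr0n expr1n add0r sqrtr1 mul1r.
by rewrite /rnorm !normc_def/= !expr0n/= !addr0 !sqrtr_sqr.
Qed.

(** Superlevel sets of a Lipschitz function are open. *)
Lemma measurable_lipschitz (g : borelC R -> R) :
  (forall z w : R[i], `|g z - g w| <= rnorm (z - w)) ->
  measurable_fun setT g.
Proof.
move=> glip; apply: (measurability _ (RGenOInfty.measurableE R)) => //.
move=> _ [_ [a ->] <-]; rewrite setTI.
apply: sub_sigma_algebra => /=; rewrite openE => z /= az.
rewrite /interior; have /near_rnorm : 0 < g z - a.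
  by move: az; rewrite in_itv/= andbT subr_gt0.
move=> /(_ z); apply: filterS => w /= zw; rewrite in_itv/= andbT.
have := le_lt_trans (glip z w) zw; have := ler_norm (g z - g w); lra.
Qed.

Lemma measurable_Re : measurable_fun setT (@complex.Re R : borelC R -> R).
Proof.
apply: measurable_lipschitz => z w; rewrite -[_ - _]/(complex.Re z - complex.Re w).
suff <- : complex.Re (z - w) = complex.Re z - complex.Re w by exact: Re_le_rnorm.
by case: z w => [a b] [c d].
Qed.

Lemma measurable_Im : measurable_fun setT (@complex.Im R : borelC R -> R).
Proof.
apply: measurable_lipschitz => z w.
suff <- : complex.Im (z - w) = complex.Im z - complex.Im w by exact: Im_le_rnorm.
by case: z w => [a b] [c d].
Qed.

Lemma measurable_rnormB (l : R[i]) :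
  measurable_fun setT (fun z : borelC R => rnorm (l - z)).
Proof.
apply: measurable_lipschitz => z w.
rewrite ler_norml lerNl opprB; apply/andP; split.
  by rewrite (le_trans (ler_rnormB _ _))// opprB addrC addrA subrK.
rewrite (le_trans (ler_rnormB _ _))// opprB addrC addrA subrK.
by rewrite rnormB.
Qed.

Lemma measurable_rnorm :
  measurable_fun setT (fun z : borelC R => rnorm (z : R[i])).
Proof.
have := measurable_rnormB 0; apply: eq_measurable_fun => z _.
by rewrite sub0r rnormN.
Qed.

(** The plane is second countable: an open set is a countable union of squares
    with rational centers, whose preimages are cut out by the two real
    coordinates. *)
Lemma measurable_fun_ReIm d (T : measurableType d) (h : T -> borelC R) :
  measurable_fun setT (fun t => complex.Re (h t)) ->
  measurable_fun setT (fun t => complex.Im (h t)) ->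
  measurable_fun setT h.
Proof.
move=> mRe mIm.
apply: (@measurability _ _ T (borelC R) setT h (@open R[i]^o)) => //.
move=> _ [G oG <-]; rewrite setTI.
pose square (q : rat * rat * nat) : set R[i] :=
  [set z | ball (ratr q.1.1 : R) q.2.+1%:R^-1 (complex.Re z) /\
           ball (ratr q.1.2 : R) q.2.+1%:R^-1 (complex.Im z)].
have msq q : measurable (h @^-1` square q).
  rewrite (_ : h @^-1` square q =
    (fun t => complex.Re (h t)) @^-1` ball (ratr q.1.1 : R) q.2.+1%:R^-1 `&`
    (fun t => complex.Im (h t)) @^-1` ball (ratr q.1.2 : R) q.2.+1%:R^-1) //.
  by apply: measurableI; rewrite -[X in measurable X]setTI;
     [apply: mRe|apply: mIm] => //; apply: open_measurable; exact: ball_open.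
have -> : h @^-1` G =
    \bigcup_q (if `[< square q `<=` G >] then h @^-1` (square q) else set0).
  apply/seteqP; split => [t /= Ght|t [q _]]; last first.
    by case: asboolP => // sG ht; exact: sG.
  move: oG; rewrite openE => /(_ _ Ght)/nbhs_rnorm[e e0 eG].
  have e4 : 0 < e / 4 by rewrite divr_gt0.
  have [n _ /(_ _ (leqnn n)) /= ne] := near_infty_natSinv_lt (PosNum e4).
  have n0 : 0 < (n.+1%:R : R)^-1 by rewrite invr_gt0.
  have /rat_in_itvoo[p] : complex.Re (h t) - n.+1%:R^-1 < complex.Re (h t).
    by rewrite ltrBlDr ltrDl.
  rewrite in_itv/= => /andP[p1 p2].
  have /rat_in_itvoo[q] : complex.Im (h t) - n.+1%:R^-1 < complex.Im (h t).
    by rewrite ltrBlDr ltrDl.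
  rewrite in_itv/= => /andP[q1 q2].
  exists (p, q, n) => //; case: asboolP => [_|].
    rewrite /square /preimage/= /ball/= !ltr_norml; move: p1 p2 q1 q2 n0.
    by move: (n.+1%:R^-1) => i *; split; apply/andP; split; lra.
  case=> z [/=]; rewrite /ball/= !ltr_norml => /andP[z1 z2] /andP[z3 z4].
  apply: eG; apply: (le_lt_trans (rnorm_le_ReIm _)).
  have -> : complex.Re (h t - z) = complex.Re (h t) - complex.Re z.
    by case: (h t) (z) => [? ?] [].
  have -> : complex.Im (h t - z) = complex.Im (h t) - complex.Im z.
    by case: (h t) (z) => [? ?] [].
  have le1 (x : R) : - (e / 2) < x -> x < e / 2 -> `|x| < e / 2.
    by move=> ? ?; rewrite ltr_norml; apply/andP.
  rewrite (_ : e = e / 2 + e / 2); last by lra.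
  move: z1 z2 z3 z4 p1 p2 q1 q2 ne n0; move: (n.+1%:R^-1) => i *.
  by apply: ltrD; apply: le1; lra.
apply: countable_bigcupT_measurable => [|q]; first exact: countableP.
by case: ifP => _; [exact: msq|exact: measurable0].
Qed.

Lemma measurable_funMC d (T : measurableType d) (f g : T -> borelC R) :
  measurable_fun setT f -> measurable_fun setT g ->
  measurable_fun setT (fun t => (f t : R[i]) * g t : borelC R).
Proof.
move=> mf mg.
have mRe (h : T -> borelC R) : measurable_fun setT h ->
  measurable_fun setT (fun t => complex.Re (h t)).
  by move=> mh; apply: measurableT_comp mh; exact: measurable_Re.
have mIm (h : T -> borelC R) : measurable_fun setT h ->
  measurable_fun setT (fun t => complex.Im (h t)).
  by move=> mh; apply: measurableT_comp mh; exact: measurable_Im.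
apply: measurable_fun_ReIm.
  rewrite (_ : (fun _ => _) = (fun t => complex.Re (f t) * complex.Re (g t) -
    complex.Im (f t) * complex.Im (g t))).
    by apply: measurable_funB; apply: measurable_funM; auto.
  by apply/funext => t; case: (f t) (g t) => [a b] [c d'].
rewrite (_ : (fun _ => _) = (fun t => complex.Re (f t) * complex.Im (g t) +
    complex.Im (f t) * complex.Re (g t))).
  by apply: measurable_funD;
     apply: measurable_funM; auto.
by apply/funext => t; case: (f t) (g t) => [a b] [c d'].
Qed.

(** The resolvent function [1 / (z - l)], tamed inside the ball of radius [e]
    so as to be Borel and bounded by [1 / e] everywhere. *)
Definition tame_inv (l : R[i]) (e : R) (z : R[i]) : R[i] :=
  conjc (z - l) * ((Num.max (e ^+ 2) (rnorm (l - z) ^+ 2))^-1)%:C.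

Lemma tame_invE l e z : 0 < e -> e <= rnorm (l - z) ->
  (z - l) * tame_inv l e z = 1.
Proof.
move=> e0 ez; rewrite /tame_inv mulrA -sqr_normc norm_rnorm rnormB.
have lz0 : 0 < rnorm (l - z) by exact: lt_le_trans ez.
rewrite max_r; last by rewrite ler_sqr ?nnegrE ?rnorm_ge0// ltW.
rewrite -rmorphXn -rmorphM/= divff//.
by rewrite sqrf_eq0 gt_eqF.
Qed.

Lemma tame_inv_le l e z : 0 < e -> rnorm (tame_inv l e z) <= e^-1.
Proof.
move=> e0; rewrite /tame_inv rnormM rnormC; last first.
  by rewrite invr_ge0 le_max sqr_ge0.
have -> : rnorm (conjc (z - l)) = rnorm (l - z).
  by rewrite /rnorm normcJ -/(rnorm _) rnormB.
rewrite ler_pdivrMr; last by rewrite lt_max exprn_gt0.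
rewrite mulrC ler_pdivlMr//.
have := rnorm_ge0 (l - z); set r := rnorm _ => r0.
by case: (leP r e) => re; rewrite le_max; apply/orP; [left|right]; nra.
Qed.

Lemma measurable_tame_inv l e : 0 < e ->
  measurable_fun setT (tame_inv l e : borelC R -> borelC R).
Proof.
move=> e0; pose g (r : R) := (Num.max (e ^+ 2) (r ^+ 2))^-1.
have mg : measurable_fun setT g.
  apply: continuous_measurable_fun => r; apply: cvgV.
    by rewrite gt_eqF// lt_max exprn_gt0.
  apply: (@continuous_max _ R^o (fun=> e ^+ 2) (fun s => s ^+ 2)).
    exact: cvg_cst.
  exact: exprn_continuous.
have mG : measurable_fun setT (fun z : borelC R => g (rnorm (l - z))).
  by apply: measurableT_comp => //; exact: measurable_rnormB.
have mRe : measurable_fun setT (fun z : borelC R => complex.Re z - complex.Re l).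
  by apply: measurable_funB => //; exact: measurable_Re.
have mIm : measurable_fun setT (fun z : borelC R => complex.Im l - complex.Im z).
  by apply: measurable_funB => //; exact: measurable_Im.
apply: measurable_fun_ReIm.
  rewrite (_ : (fun _ => _) = (fun z : borelC R =>
    (complex.Re z - complex.Re l) * g (rnorm (l - z)))).
    exact: measurable_funM.
  apply/funext => z; rewrite /tame_inv -/(g _).
  by case: z (l) => [a b] [c d] /=; rewrite mulr0 subr0.
rewrite (_ : (fun _ => _) = (fun z : borelC R =>
    (complex.Im l - complex.Im z) * g (rnorm (l - z)))).
  exact: measurable_funM.
apply/funext => z; rewrite /tame_inv -/(g _).
by case: z (l) => [a b] [c d] /=; rewrite mulr0 add0r opprB.
Qed.

Lemma measurable_indicC (K : set (borelC R)) : measurable K ->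
  measurable_fun setT (fun z : borelC R => (\1_K z : R)%:C : borelC R).
Proof.
move=> mK; apply: measurable_fun_ReIm => /=; last exact: measurable_cst.
exact: measurable_indic.
Qed.

End ComplexMeasurability.

(** * Norms and null sets in the representation space *)

Section AlmostEverywhereInVA.
Variables (R : realType) (mu : multiplicity -> {finite_measure set (borelC R) -> \bar R}).

(** The null sets of the blocks are unrelated, so statements up to null sets
    are made block by block; [VA_eq] is the special case of an equality. *)
Definition ae_coord (P : multiplicity * nat -> R[i] -> Prop) : Prop :=
  forall p, coordinates p -> {ae mu p.1, forall z, P p z}.

Lemma ae_muS m (P Q : R[i] -> Prop) : (forall z, P z -> Q z) ->
  {ae mu m, forall z, P z} -> {ae mu m, forall z, Q z}.
Proof. exact: (@filterS _ _ (ae_filter_ringOfSetsType (mu m))). Qed.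

Lemma ae_muI m (P Q : R[i] -> Prop) :
  {ae mu m, forall z, P z} -> {ae mu m, forall z, Q z} ->
  {ae mu m, forall z, P z /\ Q z}.
Proof. exact: (@filterI _ _ (ae_filter_ringOfSetsType (mu m))). Qed.

Lemma ae_coordW (P : multiplicity * nat -> R[i] -> Prop) :
  (forall p z, P p z) -> ae_coord P.
Proof. by move=> h p _; apply: aeW => z. Qed.

Lemma ae_coordS (P Q : multiplicity * nat -> R[i] -> Prop) :
  (forall p z, P p z -> Q p z) -> ae_coord P -> ae_coord Q.
Proof. by move=> PQ aeP p cp; apply: ae_muS (aeP p cp) => z; exact: PQ. Qed.

Lemma ae_coordI (P Q : multiplicity * nat -> R[i] -> Prop) :
  ae_coord P -> ae_coord Q -> ae_coord (fun p z => P p z /\ Q p z).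
Proof. by move=> aeP aeQ p cp; apply: ae_muI; [exact: aeP|exact: aeQ]. Qed.

Definition measurable_rep (f : rep R) : Prop := forall p, coordinates p ->
  measurable_fun setT (f p.1 p.2 : borelC R -> borelC R).

Lemma measurable_sqnorm (f : rep R) p : measurable_rep f -> coordinates p ->
  measurable_fun setT (fun z : borelC R => (rnorm (f p.1 p.2 z) ^+ 2)%:E).
Proof.
move=> mf cp; apply/measurable_EFinP; apply: measurable_funX.
by apply: measurableT_comp (mf p cp); exact: measurable_rnorm.
Qed.

Lemma le_VA_sqnorm (f g : rep R) : measurable_rep f -> measurable_rep g ->
  ae_coord (fun p z => rnorm (f p.1 p.2 z) <= rnorm (g p.1 p.2 z)) ->
  (VA_sqnorm mu f <= VA_sqnorm mu g)%E.
Proof.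
move=> Vf Vg fg; apply: le_esum => p cp.
apply: ae_ge0_le_integral => //.
- by move=> z _; rewrite lee_fin sqr_ge0.
- exact: measurable_sqnorm.
- by move=> z _; rewrite lee_fin sqr_ge0.
- exact: measurable_sqnorm.
apply: ae_muS (fg p cp) => z fgz _.
by rewrite lee_fin ler_sqr ?nnegrE ?rnorm_ge0.
Qed.

Lemma VA_sqnormD_disjoint (f g h : rep R) :
  measurable_rep f -> measurable_rep g -> measurable_rep h ->
  ae_coord (fun p z => h p.1 p.2 z = f p.1 p.2 z + g p.1 p.2 z /\
                       (f p.1 p.2 z = 0 \/ g p.1 p.2 z = 0)) ->
  VA_sqnorm mu h = (VA_sqnorm mu f + VA_sqnorm mu g)%E.
Proof.
move=> Vf Vg Vh hfg; rewrite -esumD; last 2 first.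
- by move=> p _; apply: integral_ge0 => z _; rewrite lee_fin sqr_ge0.
- by move=> p _; apply: integral_ge0 => z _; rewrite lee_fin sqr_ge0.
apply: eq_esum => p cp; rewrite -ge0_integralD//; last 4 first.
- by move=> z _; rewrite lee_fin sqr_ge0.
- exact: measurable_sqnorm.
- by move=> z _; rewrite lee_fin sqr_ge0.
- exact: measurable_sqnorm.
apply: ae_eq_integral => //.
- exact: measurable_sqnorm.
- by apply: emeasurable_funD; exact: measurable_sqnorm.
apply: ae_muS (hfg p cp) => z [-> [] ->] _; rewrite rnorm0 ?addr0 ?add0r.
  by rewrite expr0n/= add0e.
by rewrite expr0n/= adde0.
Qed.

Lemma VA_sqnorm_eq0 (f : rep R) : measurable_rep f -> VA_sqnorm mu f = 0%E ->
  ae_coord (fun p z => f p.1 p.2 z = 0).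
Proof.
move=> Vf f0 p cp.
have ge0 q : (0 <= \int[mu q.1]_z (rnorm (f q.1 q.2 z) ^+ 2)%:E)%E.
  by apply: integral_ge0 => z _; rewrite lee_fin sqr_ge0.
have int0 : (\int[mu p.1]_z (rnorm (f p.1 p.2 z) ^+ 2)%:E)%E = 0%E.
  apply/eqP; rewrite eq_le ge0 andbT -f0; apply: esum_ge.
  exists [set p]; last by rewrite fsbig_set1.
  by split => // _ ->.
have /ae_eq_integral_abs : measurable_fun setT
  (fun z : borelC R => (rnorm (f p.1 p.2 z) ^+ 2)%:E) by exact: measurable_sqnorm.
move=> /(_ (mu p.1) measurableT)[+ _].
under eq_integral => z _ do rewrite gee0_abs ?lee_fin ?sqr_ge0//.
move=> /(_ int0); apply: ae_muS => z /(_ I)/= [] /eqP.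
by rewrite sqrf_eq0 rnorm_eq0 => /eqP.
Qed.

End AlmostEverywhereInVA.

(** * Functional calculus through the representation *)

Section SpectralCalculus.
Variables (R : realType) (H : completeNormedModType R[i]).
Variables (ip : {dot H for conjC}) (Hip : hilbert_form ip).
Variable mu : multiplicity -> {finite_measure set (borelC R) -> \bar R}.
Variables (U : H -> rep R) (HU : unitary_onto_VA mu U).

Notation ae_coord := (ae_coord mu).

Lemma U_measurable x : measurable_rep (U x).
Proof. by case: HU => /(_ x)[]. Qed.

Lemma U_sqnorm x : VA_sqnorm mu (U x) = (rnorm x ^+ 2)%:E.
Proof. by case: HU => _ _ ->. Qed.

Lemma U_linear (a : R[i]) x y : ae_coord (fun p z =>
  U (a *: x + y) p.1 p.2 z = a * U x p.1 p.2 z + U y p.1 p.2 z).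
Proof. by case: HU => _ + _ _; apply. Qed.

Lemma U_eq0 : ae_coord (fun p z => U 0 p.1 p.2 z = 0).
Proof.
apply: VA_sqnorm_eq0; first exact: U_measurable.
by rewrite U_sqnorm rnorm0 expr0n.
Qed.

Lemma U_scale (a : R[i]) x : ae_coord (fun p z =>
  U (a *: x) p.1 p.2 z = a * U x p.1 p.2 z).
Proof.
have := ae_coordI (U_linear a x 0) U_eq0; rewrite addr0.
by apply: ae_coordS => p z [-> ->]; rewrite addr0.
Qed.

Lemma U_sub x y : ae_coord (fun p z =>
  U (x - y) p.1 p.2 z = U x p.1 p.2 z - U y p.1 p.2 z).
Proof.
have := U_linear (- 1) y x; rewrite scaleN1r addrC.
by apply: ae_coordS => p z ->; rewrite mulN1r addrC.
Qed.

Lemma U_dominated x y :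
  ae_coord (fun p z => rnorm (U x p.1 p.2 z) <= rnorm (U y p.1 p.2 z)) ->
  rnorm x <= rnorm y.
Proof.
move=> xy; have := le_VA_sqnorm (U_measurable x) (U_measurable y) xy.
by rewrite !U_sqnorm lee_fin ler_sqr ?nnegrE ?rnorm_ge0.
Qed.

Lemma U_dominatedZ (C : R) x y : 0 <= C ->
  ae_coord (fun p z => rnorm (U x p.1 p.2 z) <= C * rnorm (U y p.1 p.2 z)) ->
  rnorm x <= C * rnorm y.
Proof.
move=> C0 xy; rewrite -(rnormC C0) -rnormZ; apply: U_dominated.
apply: ae_coordS (ae_coordI xy (U_scale C%:C y)) => p z [+ ->].
by rewrite rnormM rnormC.
Qed.

Lemma U_eq0P x : x = 0 <-> ae_coord (fun p z => U x p.1 p.2 z = 0).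
Proof.
split=> [->|x0]; first exact: U_eq0.
apply/eqP; rewrite -rnorm_eq0 eq_le rnorm_ge0 andbT -(mul0r (rnorm x)).
apply: U_dominatedZ => //; apply: ae_coordS x0 => p z ->.
by rewrite rnorm0 mulr0.
Qed.

Lemma U_inj x y : VA_eq mu (U x) (U y) -> x = y.
Proof.
move=> xy; apply/eqP; rewrite -subr_eq0; apply/eqP/U_eq0P.
by apply: ae_coordS (ae_coordI xy (U_sub x y)) => p z [-> ->]; rewrite subrr.
Qed.

(** The representation carries no inner product, only norms; orthogonality is
    recovered from Pythagoras' identity for all multiples of [y]. *)
Lemma U_disjoint x y :
  ae_coord (fun p z => U x p.1 p.2 z = 0 \/ U y p.1 p.2 z = 0) -> ip x y = 0.
Proof.
move=> dis; apply: (pythagoras_orthogonal Hip) => a.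
have disa : ae_coord (fun p z =>
    U (1 *: x + a *: y) p.1 p.2 z = U x p.1 p.2 z + U (a *: y) p.1 p.2 z /\
    (U x p.1 p.2 z = 0 \/ U (a *: y) p.1 p.2 z = 0)).
  apply: ae_coordS (ae_coordI (ae_coordI dis (U_scale a y))
    (U_linear 1 x (a *: y))) => p z [[xy0 aE] ->].
  rewrite mul1r; split=> //; case: xy0 => [->|y0]; first by left.
  by right; rewrite aE y0 mulr0.
have := VA_sqnormD_disjoint (U_measurable _) (U_measurable _) (U_measurable _) disa.
by rewrite !U_sqnorm -EFinD scale1r => -[->]; rewrite rnormZ exprMn.
Qed.

(** Every bounded Borel function of [A] acts on [H]: surjectivity of [U]
    provides the value. *)
Lemma U_multiply (phi : R[i] -> R[i]) (C : R) x :
  measurable_fun setT (phi : borelC R -> borelC R) -> 0 <= C ->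
  (forall z, rnorm (phi z) <= C) ->
  exists y, ae_coord (fun p z => U y p.1 p.2 z = phi z * U x p.1 p.2 z).
Proof.
move=> mphi C0 phiC.
pose f : rep R := fun m k z => phi z * U x m k z.
have mf : measurable_rep f.
  by move=> p cp; apply: measurable_funMC => //; exact: U_measurable.
have Vf : in_VA mu f.
  split; first exact: mf.
  apply: le_lt_trans (ltry (rnorm (C%:C *: x) ^+ 2)); rewrite -U_sqnorm.
  apply: le_VA_sqnorm => //; first exact: U_measurable.
  apply: ae_coordS (U_scale C%:C x) => p z ->; rewrite /f !rnormM rnormC//.
  by rewrite ler_wpM2r ?rnorm_ge0.
by case: HU => _ _ _ /(_ f Vf)[y yf]; exists y.
Qed.

(** Membership in the range of the spectral projection of the Borel set [K]. *)
Definition lives_on (K : set R[i]) (x : H) : Prop :=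
  ae_coord (fun p z => ~ K z -> U x p.1 p.2 z = 0).

Lemma lives_onS (K L : set R[i]) x : K `<=` L -> lives_on K x -> lives_on L x.
Proof.
by move=> KL; apply: ae_coordS => p z Kx Lz; apply: Kx => /KL.
Qed.

Lemma lives_on0 K : lives_on K 0.
Proof. by apply: ae_coordS U_eq0. Qed.

Lemma lives_onD K (a : R[i]) x y :
  lives_on K x -> lives_on K y -> lives_on K (a *: x + y).
Proof.
move=> Kx Ky; apply: ae_coordS (ae_coordI (ae_coordI Kx Ky) (U_linear a x y)).
by move=> p z [[xz yz] ->] Kz; rewrite xz// yz// mulr0 add0r.
Qed.

Lemma lives_onZ K (a : R[i]) x : lives_on K x -> lives_on K (a *: x).
Proof.
by move=> Kx; rewrite -[_ *: _]addr0; apply: lives_onD => //; exact: lives_on0.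
Qed.

Lemma lives_on_sum K n (a : 'I_n -> R[i]) (x : 'I_n -> H) :
  (forall i, lives_on K (x i)) -> lives_on K (\sum_(i < n) a i *: x i).
Proof.
move=> Kx; apply: big_rec => [|i y _]; first exact: lives_on0.
exact: lives_onD.
Qed.

Lemma lives_on_disjoint K L x y : K `&` L = set0 ->
  lives_on K x -> lives_on L y -> ip x y = 0.
Proof.
move=> KL0 Kx Ly; apply: U_disjoint; apply: ae_coordS (ae_coordI Kx Ly).
move=> p z [xz yz]; have [Kz|/xz ->] := pselect (K z); last by left.
right; apply: yz => Lz; suff : set0 z by []; by rewrite -KL0.
Qed.

Lemma spectral_cut (K : set (borelC R)) x : measurable K ->
  exists y, ae_coord (fun p z =>
    U y p.1 p.2 z = if z \in K then U x p.1 p.2 z else 0).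
Proof.
move=> mK; have [z|y yE] := U_multiply x (measurable_indicC mK) (@ler01 R).
  by rewrite indicE; case: (z \in K); rewrite ?rnorm0 ?rnorm1.
exists y; apply: ae_coordS yE => p z ->; rewrite indicE.
by case: (z \in K); rewrite ?mul1r ?mul0r.
Qed.

(** The witness is the indicator of [K], placed in the first copy of the block [m]. *)
Lemma exists_lives_on (K : set (borelC R)) m : measurable K -> mu m K != 0%E ->
  exists2 x, x != 0 & lives_on K x.
Proof.
move=> mK muK.
pose f : rep R := fun m' k z =>
  if `[< m' = m /\ k = 0%N >] then (\1_K z : R)%:C else 0.
have c0 : coordinates (m, 0%N) by case: (m).
have mf : measurable_rep f.
  move=> p cp; rewrite /f; case: asboolP => _; last exact: measurable_cst.
  exact: measurable_indicC.
have fE : VA_sqnorm mu f = mu m K.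
  rewrite /VA_sqnorm (esumID [set (m, 0%N)]); last first.
    by move=> p _; apply: integral_ge0 => z _; rewrite lee_fin sqr_ge0.
  rewrite [X in (_ + X)%E]esum1 ?adde0; last first.
    move=> [m' k] [_ /= mk]; apply: integral0_eq => z _.
    rewrite /f/=; case: asboolP => [[mE kE]|_]; last by rewrite rnorm0 expr0n.
    by exfalso; apply: mk; rewrite mE kE.
  rewrite (_ : _ `&` _ = [set (m, 0%N)]); last first.
    by apply/seteqP; split => [p []|p ->].
  rewrite esum_set1/=; last first.
    by apply: integral_ge0 => z _; rewrite lee_fin sqr_ge0.
  transitivity (\int[mu m]_z (\1_K z)%:E)%E; last by rewrite integral_indic// setIT.
  apply: eq_integral => z _.
  rewrite /f; case: asboolP => [_|[]//]; rewrite indicE.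
  by case: (z \in K); rewrite ?rnorm0 ?rnorm1 ?expr0n ?expr1n.
have Vf : in_VA mu f.
  split; first exact: mf.
  by rewrite fE ltey_eq fin_num_measure.
case: HU => _ _ _ /(_ f Vf)[x xf]; exists x.
  apply: contra muK => /eqP x0; rewrite -fE eq_le.
  have := @le_VA_sqnorm _ mu f (U x) mf (U_measurable x).
  rewrite U_sqnorm x0 rnorm0 expr0n/= => -> /=; last first.
    by apply: ae_coordS xf => p z; rewrite x0 => ->.
  by rewrite fE measure_ge0.
apply: ae_coordS xf => p z -> Kz; rewrite /f; case: asboolP => // _.
by rewrite indicE memNset.
Qed.

End SpectralCalculus.

(** * Spectrum and spectral measure *)

Section SpectrumAndSpectralMeasure.
Variables (R : realType) (H : completeNormedModType R[i]).
Variables (ip : {dot H for conjC}) (Hip : hilbert_form ip).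
Variable mu : multiplicity -> {finite_measure set (borelC R) -> \bar R}.
Variables (U : H -> rep R) (HU : unitary_onto_VA mu U).
Variable A : {linear H -> H}.
Hypothesis HM : forall x, VA_eq mu (U (A x)) (fun m k z => z * U x m k z).

Notation ae_coord := (ae_coord mu).
Notation lives_on := (lives_on mu U).

Lemma measurable_disc_le (a : R) :
  measurable ([set z : R[i] | rnorm z <= a] : set (borelC R)).
Proof.
rewrite -[X in measurable X]setTI.
have := @measurable_rnorm R measurableT _ (measurable_itv `]-oo, a]).
by congr measurable; apply/seteqP; split => z /=; rewrite in_itv.
Qed.

Lemma measurable_ball_rnorm (l : R[i]) (e : R) :
  measurable ([set z : R[i] | rnorm (l - z) < e] : set (borelC R)).
Proof.
rewrite -[X in measurable X]setTI.
have := measurable_rnormB l measurableT (measurable_itv `]-oo, e[).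
by congr measurable; apply/seteqP; split => z /=; rewrite in_itv.
Qed.

Lemma U_iter n x : ae_coord (fun p z =>
  U (iter n A x) p.1 p.2 z = z ^+ n * U x p.1 p.2 z).
Proof.
elim: n => [|n IH]; first by apply: ae_coordW => p z; rewrite expr0 mul1r.
apply: ae_coordS (ae_coordI (HM (iter n A x)) IH) => p z /= [-> ->].
by rewrite exprS mulrA.
Qed.

Lemma lives_on_iter K n x : lives_on K x -> lives_on K (iter n A x).
Proof.
move=> Kx; apply: ae_coordS (ae_coordI (U_iter n x) Kx) => p z [-> xz] Kz.
by rewrite xz// mulr0.
Qed.

Lemma lives_on_zero x : lives_on [set z : R[i] | rnorm z <= 0] x -> A x = 0.
Proof.
move=> x0; apply/(U_eq0P HU); apply: ae_coordS (ae_coordI (HM x) x0) => p z [-> xz].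
have [->|z0] := eqVneq z 0; first by rewrite mul0r.
by rewrite xz ?mulr0//= leNgt rnorm_gt0 z0.
Qed.

(** The part of [x] outside the disc of radius [a] is scaled by more than [a]
    at each step. *)
Lemma iter_lower_bound a x : 0 <= a -> ~ lives_on [set z : R[i] | rnorm z <= a] x ->
  exists2 y : H, y != 0 & forall n,
    a ^+ n * rnorm y <= rnorm (iter n A y) <= rnorm (iter n A x).
Proof.
move=> a0 xa; have mK := measurableC (measurable_disc_le a).
have [y yE] := spectral_cut HU x mK; exists y.
  apply: contra_notN xa => /eqP/(U_eq0P HU) y0.
  apply: ae_coordS (ae_coordI yE y0) => p z [-> +] za.
  by rewrite mem_set.
move=> n; apply/andP; split.
  rewrite -(rnormC (exprn_ge0 n a0)) -rnormZ; apply: (U_dominated HU).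
  apply: ae_coordS (ae_coordI (ae_coordI yE (U_scale HU (a ^+ n)%:C y)) (U_iter n y)).
  move=> p z [[yz ->] ->]; rewrite yz !rnormM rnormC ?exprn_ge0// rnormX.
  case: ifPn => [|_]; last by rewrite rnorm0 !mulr0.
  rewrite inE/= => /negP; rewrite -ltNge => /ltW az.
  by rewrite ler_wpM2r ?rnorm_ge0// lerXn2r ?nnegrE ?rnorm_ge0.
apply: (U_dominated HU); apply: ae_coordS (ae_coordI yE (ae_coordI (U_iter n y) (U_iter n x))).
move=> p z [yz [-> ->]]; rewrite yz; case: ifP => // _.
by rewrite mulr0 rnorm0 rnorm_ge0.
Qed.

(** Only the part of the orbit over [K] is seen by [g], and there one step of
    [A] multiplies norms by at most [b]. *)
Lemma ip_iter_upper_bound (K : set (borelC R)) b g x n : measurable K -> 0 <= b ->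
  K `<=` [set z : R[i] | rnorm z <= b] -> lives_on K g ->
  rnorm (ip g (iter n A x)) <= b ^+ n * rnorm g * rnorm x.
Proof.
move=> mK b0 Kb Kg; have [y yE] := spectral_cut HU (iter n A x) mK.
have -> : ip g (iter n A x) = ip g y.
  apply/eqP; rewrite -subr_eq0 -linearBr; apply/eqP.
  apply: (U_disjoint Hip HU).
  apply: ae_coordS (ae_coordI (ae_coordI Kg yE) (U_sub HU (iter n A x) y)).
  move=> p z [[gz yz] ->]; rewrite yz; case: ifPn => [_|].
    by right; rewrite subrr.
  by move=> /negP; rewrite inE => /gz; left.
apply: le_trans (CauchySchwarz_rnorm Hip _ _) _.
rewrite [b ^+ n * _]mulrC -mulrA ler_wpM2l ?rnorm_ge0//.
apply: (U_dominatedZ HU); first exact: exprn_ge0.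
apply: ae_coordS (ae_coordI yE (U_iter n x)) => p z [-> ->].
case: ifPn => [|_]; last by rewrite rnorm0 mulr_ge0 ?exprn_ge0 ?rnorm_ge0.
rewrite inE => /Kb/= zb; rewrite rnormM rnormX.
by rewrite ler_wpM2r ?rnorm_ge0// lerXn2r ?nnegrE ?rnorm_ge0.
Qed.

Lemma U_shift (l : R[i]) x : ae_coord (fun p z =>
  U (shift_op A l x) p.1 p.2 z = (z - l) * U x p.1 p.2 z).
Proof.
apply: ae_coordS (ae_coordI (ae_coordI (HM x) (U_scale HU l x))
  (U_sub HU (A x) (l *: x))) => p z [[Ax lx] ->].
by rewrite Ax lx mulrBl.
Qed.

(** If no nonzero vector lives near [l], then [1 / (z - l)] is essentially
    bounded and multiplication by it inverts [A - l]. *)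
Lemma spectrum_lives_on (l : R[i]) (e : R) : 0 < e -> spectrum A l ->
  exists2 x : H, x != 0 & lives_on [set z : R[i] | rnorm (l - z) < e] x.
Proof.
move=> e0 Al; apply: contrapT => noball; apply: Al.
have far : ae_coord (fun p z => (z - l) * tame_inv l e z = 1).
  move=> p cp; have mB := measurable_ball_rnorm l e.
  have mu0 : mu p.1 [set z : R[i] | rnorm (l - z) < e] = 0%E.
    by apply: contra_notP noball => /eqP; exact: exists_lives_on.
  exists [set z : R[i] | rnorm (l - z) < e]; split => // z /=.
  by apply: contra_notP => /negP; rewrite -leNgt; exact: tame_invE.
have e1 : 0 <= e^-1 by rewrite invr_ge0 ltW.
have /choice[B BE] := fun y => U_multiply HU y (measurable_tame_inv l e0) e1
  (fun z => tame_inv_le l z e0).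
have linB : linear B.
  move=> a x y; apply: (U_inj HU).
  apply: ae_coordS (ae_coordI (ae_coordI (ae_coordI (BE (a *: x + y)) (BE x)) (BE y))
    (ae_coordI (U_linear HU a x y) (U_linear HU a (B x) (B y)))).
  by move=> p z [[[-> Bx] By] [-> ->]]; rewrite Bx By mulrDr mulrCA.
pose BL : {linear H -> H} := HB.pack B (GRing.isLinear.Build _ _ _ _ B linB).
exists BL; split.
- exists e^-1 => x; apply: (U_dominatedZ HU) => //.
  apply: ae_coordS (BE x) => p z ->; rewrite rnormM.
  by rewrite ler_wpM2r ?rnorm_ge0 ?tame_inv_le.
- move=> x; apply: (U_inj HU).
  apply: ae_coordS (ae_coordI (ae_coordI (BE (shift_op A l x)) (U_shift l x)) far).
  by move=> p z [[-> ->] zl]; rewrite mulrA mulrC [_ * (z - l)]mulrC zl mulr1.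
- move=> x; apply: (U_inj HU).
  apply: ae_coordS (ae_coordI (ae_coordI (U_shift l (B x)) (BE x)) far).
  by move=> p z [[-> ->] zl]; rewrite mulrA zl mul1r.
Qed.

(** The spectral measure is carried by the spectrum, so a vector living near an
    isolated spectral value lives at that point. *)
Lemma isolated_eigenvalue (l : R[i]) (e : R) :
  (forall m, (mu m).-negligible (~` spectrum A)) -> 0 < e -> spectrum A l ->
  (forall z, spectrum A z -> rnorm (l - z) < e -> z = l) ->
  ~ injective (shift_op A l).
Proof.
move=> mus e0 Al iso inj; have [x /eqP x0 xl] := spectrum_lives_on e0 Al.
apply: x0; apply: inj; rewrite [RHS]/shift_op linear0 scaler0 subr0.
apply/(U_eq0P HU).
have aes : ae_coord (fun _ => spectrum A) by move=> p _; exact: mus.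
apply: ae_coordS (ae_coordI (ae_coordI (U_shift l x) xl) aes) => p z [[-> xz] Az].
have [->|zl] := eqVneq z l; first by rewrite subrr mul0r.
by rewrite xz ?mulr0// => /(iso _ Az)/eqP; rewrite (negbTE zl).
Qed.

End SpectrumAndSpectralMeasure.

(** * Radius of the support *)

Section SupportRadius.
Variables (R : realType) (H : completeNormedModType R[i]).
Variable mu : multiplicity -> {finite_measure set (borelC R) -> \bar R}.
Variables (U : H -> rep R) (E : multiplicity -> set (borelC R)).
Hypothesis HE : carriers mu E.

Lemma scalar_measureE (N : set (borelC R)) : scalar_measure mu N =
  (mu None N + \sum_(0 <= j <oo) mu (Some j) N)%E.
Proof. exact: measure_addE. Qed.

Lemma scalar_negligible (N : set (borelC R)) :
  (scalar_measure mu).-negligible N <-> forall m, (mu m).-negligible N.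
Proof.
split=> [[B [mB B0 NB]] m|negN].
  exists B; split => //; apply/eqP; rewrite -measure_le0 -B0.
  rewrite scalar_measureE; case: m => [j|]; last by rewrite leeDl// nneseries_ge0.
  rewrite (le_trans _ (leeDr _ _)) ?measure_ge0//.
  by rewrite (@nneseriesD1 _ _ j)// leeDl// nneseries_ge0.
have /choice[B BP] := negN.
pose C := (\bigcap_j B (Some j)) `&` B None.
have mC : measurable C.
  apply: measurableI; last by case: (BP None).
  by apply: bigcapT_measurable => j; case: (BP (Some j)).
have C0 m : mu m C = 0%E.
  have [mB B0 _] := BP m; apply/eqP; rewrite -measure_le0 -B0.
  apply: le_measure; rewrite ?inE// => z [zs zn].
  by case: m {mB B0} => [j|//]; exact: zs.
exists C; split => //.
- rewrite scalar_measureE C0 add0e.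
  by apply: eseries0 => j _ _; exact: C0.
- move=> z Nz; split=> [j _|]; first by case: (BP (Some j)) => _ _; apply.
  by case: (BP None) => _ _; apply.
Qed.

(** Off its carrier [E m] the block [m] does not count, so an essential bound
    for the scalar measure is one in each coordinate separately. *)
Lemma supp_radius_le (x : H) (t : R) :
  (supp_radius mu E (U x) <= t%:E)%E <->
  lives_on mu U [set z : R[i] | rnorm z <= t] x.
Proof.
have [_ tE E0] := HE.
pose N : set (borelC R) := [set z | VA_supp E (U x) z /\ ~ (rnorm (z : R[i]) <= t)].
have NE : ~` [set z | (patch (fun=> -oo) (VA_supp E (U x))
    (fun z : borelC R => (rnorm (z : R[i]))%:E) z <= t%:E)%E] = N.
  apply/seteqP; split => z /=; rewrite /patch.
    by case: ifPn => [|_ []]; rewrite ?inE ?leNye// lee_fin.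
  by move=> [xz zt]; rewrite mem_set// lee_fin.
have -> : (supp_radius mu E (U x) <= t%:E)%E <-> (scalar_measure mu).-negligible N.
  by rewrite -NE; split => [/ess_supP|h]//; apply/ess_supP.
rewrite scalar_negligible; split => [negN p cp|xt m].
  have nE : (mu p.1).-negligible (~` E p.1).
    by exists (~` E p.1); split => //; apply: measurableC; case: HE.
  apply: negligibleS (negligibleU (negN p.1) nE) => z /=.
  move=> /not_implyP[zt /eqP Uz]; have [Ez|] := pselect (E p.1 z); last by right.
  by left; split => //; exists p.
pose F k : set (borelC R) := if `[< copy_index m k >] then
  ~` [set z : borelC R | ~ (rnorm (z : R[i]) <= t) -> U x m k z = 0] else set0.
have nF k : (mu m).-negligible (F k).
  rewrite /F; case: asboolP => mk; last exact: negligible_set0.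
  exact: (xt (m, k) mk).
have nE : (mu m).-negligible (~` E m).
  by exists (~` E m); split => //; apply: measurableC; case: HE.
apply: negligibleS (negligibleU nE (negligible_bigcup nF)) => z [[[m' k]/= [c Ez Uz]] zt].
have [Emz|] := pselect (E m z); last by left.
right; exists k => //; rewrite /F.
have mm : m' = m by apply: (tE _ _ I I); exists z.
rewrite -mm; case: asboolP => // _ /= h; move/eqP: Uz; apply.
by rewrite h.
Qed.

End SupportRadius.

(** * Independent families and geometric tails *)

Section LinearAlgebra.
Variables (R : realType) (H : completeNormedModType R[i]).
Variables (ip : {dot H for conjC}) (Hip : hilbert_form ip).

Definition free_family n (e : 'I_n -> H) : Prop :=
  forall a : 'I_n -> R[i], \sum_(i < n) a i *: e i = 0 -> forall i, a i = 0.

Lemma orthogonal_free n (e : 'I_n -> H) : (forall i, e i != 0) ->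
  (forall i j, i != j -> ip (e i) (e j) = 0) -> free_family e.
Proof.
move=> e0 eo a ae0 j; have := congr1 (ip^~ (e j)) ae0.
rewrite /= linear0l linear_sumlz (bigD1 j)//= big1 ?addr0 => [|i ij].
  rewrite linearZl_LR/= Hip => /eqP.
  by rewrite mulf_eq0 sqrf_eq0 normr_eq0 (negbTE (e0 j)) orbF => /eqP.
by rewrite linearZl_LR/= eo// mulr0.
Qed.

(** Orthogonality to the [w j] is a linear system with more unknowns than
    equations: the Gram matrix has a nontrivial left kernel. *)
Lemma free_orthogonal_combination n m (e : 'I_n -> H) (w : 'I_m -> H) :
  (m < n)%N -> free_family e ->
  exists a : 'I_n -> R[i], \sum_(i < n) a i *: e i != 0 /\
    forall j, ip (\sum_(i < n) a i *: e i) (w j) = 0.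
Proof.
move=> mn fe; pose G := \matrix_(i < n, j < m) ip (e i) (w j).
have /rowV0Pn[v] : kermx G != 0.
  by rewrite -mxrank_eq0 mxrank_ker subn_eq0 -ltnNge (leq_ltn_trans (rank_leq_col _)).
move=> /sub_kermxP vG v0; exists (v 0); split.
  apply: contra v0 => /eqP/fe a0; apply/eqP/rowP => i.
  by rewrite a0 mxE.
move=> j; have /rowP/(_ j) := vG; rewrite !mxE => <-.
rewrite linear_sumlz; apply: eq_bigr => i _.
by rewrite linearZl_LR/= mxE.
Qed.

Lemma infinite_dimensional_free n :
  infinite_dimensional H -> exists e : 'I_n -> H, free_family e.
Proof.
move=> Hinf; elim: n => [|n [e fe]].
  by exists (fun=> 0) => a _ [].
have [x xe] : exists x, forall a : 'I_n -> R[i], x <> \sum_(i < n) a i *: e i.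
  apply: contrapT => h; apply: Hinf; exists n, e => x.
  apply: contrapT => hx; apply: h; exists x => a xa; apply: hx.
  by exists a.
exists (fun i => if unlift ord0 i is Some j then e j else x) => a.
rewrite big_ord_recl unlift_none.
under eq_bigr do rewrite liftK.
have [a0|a0] := eqVneq (a ord0) 0.
  rewrite a0 scale0r add0r => /fe h i; have [j ->|->//] := unliftP ord0 i.
  exact: (h j).
move=> /eqP; rewrite addr_eq0 => /eqP/(congr1 ( *:%R (a ord0)^-1)).
rewrite scalerA mulVf// scale1r -sumrN scaler_sumr => xE.
case: (xe (fun i => - ((a ord0)^-1 * a (lift ord0 i)))).
by rewrite xE; apply: eq_bigr => i _; rewrite scalerN scalerA scaleNr.
Qed.

End LinearAlgebra.

Section GeometricTails.
Variable R : realType.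

Lemma geometric_tail_le (q : R) n0 n1 : 0 <= q < 1 ->
  \sum_(n <- iota 0 n1) (if (n0 <= n)%N then q ^+ n else 0) <= q ^+ n0 / (1 - q).
Proof.
move=> /andP[q0 q1]; have q1' : 0 < 1 - q by rewrite subr_gt0.
rewrite ler_pdivlMr//.
suff : (\sum_(n <- iota 0 n1) (if (n0 <= n)%N then q ^+ n else 0)) * (1 - q)
    <= q ^+ n0 - q ^+ maxn n0 n1.
  by move=> /le_trans; apply; rewrite gerBl exprn_ge0.
elim: n1 => [|n1 IH]; first by rewrite big_nil mul0r maxn0 subrr.
rewrite -addn1 iotaD big_cat big_seq1 add0n/= addn1 mulrDl.
case: leqP IH => n01 IH.
  rewrite (maxn_idPr _) ?(leq_trans n01)// exprS.
  move: IH; set S := (X in X * _).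
  by move: (q ^+ n0) (q ^+ n1) => a b; lra.
by rewrite mul0r addr0 (maxn_idPl _).
Qed.

Lemma sum_uniq_subset (T : eqType) (F s : seq T) (u : T -> R) :
  uniq F -> uniq s -> {subset F <= s} -> (forall p, 0 <= u p) ->
  \sum_(p <- F) u p <= \sum_(p <- s) u p.
Proof.
move=> uF us Fs u0; rewrite [leRHS](bigID (mem F))/= -[X in X + _]big_filter.
rewrite [X in _ <= X + _](perm_big F)/= ?lerDl ?sumr_ge0//.
apply: uniq_perm => //; first exact: filter_uniq.
by move=> p; rewrite mem_filter; case: (boolP (p \in F)) => //= /Fs.
Qed.

Lemma exists_expr_lt (q e : R) : 0 <= q < 1 -> 0 < e -> exists n, q ^+ n < e.
Proof.
move=> /andP[q0 q1] e0.
have /cvgr0Pnorm_lt/(_ e e0)[n _ /(_ n (leqnn n))] : q ^+ n @[n --> \oo] --> 0.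
  by apply: cvg_expr; rewrite ger0_norm.
by rewrite /= ger0_norm ?exprn_ge0//; exists n.
Qed.

(** A finite set of indices lies in a rectangle of [n1] rows over [S], where
    each element of [S] contributes a truncated geometric tail. *)
Lemma esum_geometric_tail_le (T : choiceType) (S : {fset T}) (D : set (nat * T))
    (t : nat * T -> R) (M q : R) n0 :
  0 <= M -> 0 <= q < 1 -> (forall p, D p -> p.2 \in S) ->
  (forall p, D p -> t p <= M * (if (n0 <= p.1)%N then q ^+ p.1 else 0)) ->
  (\esum_(p in D) (t p)%:E <= (#|` S|%:R * (M * (q ^+ n0 / (1 - q))))%:E)%E.
Proof.
move=> M0 q01 DS tM; have q0 : 0 <= q by case/andP: q01.
pose u (p : nat * T) := M * (if (n0 <= p.1)%N then q ^+ p.1 else 0).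
have u0 p : 0 <= u p by rewrite /u mulr_ge0//; case: ifP; rewrite ?exprn_ge0.
apply: ge_ereal_sup => _ [X [finX XD] <-].
rewrite fsbig_finite//= sumEFin lee_fin.
pose F := fset_set X; pose n1 := (\max_(p <- F) p.1).+1.
pose s := [seq (n, x) | n <- iota 0 n1, x <- enum_fset S].
apply: (@le_trans _ _ (\sum_(p <- F) u p)).
  rewrite big_seq [leRHS]big_seq; apply: ler_sum => p pF; apply: tM; apply: XD.
  by move: pF; rewrite in_fset_set// inE.
apply: (@le_trans _ _ (\sum_(p <- s) u p)).
  apply: sum_uniq_subset => //.
    by apply: allpairs_uniq; [exact: iota_uniq|exact: fset_uniq|move=> [? ?] []].
  move=> p pF; apply/allpairsP; exists p; split; last by case: (p).
    rewrite mem_iota add0n ltnS/=; exact: leq_bigmax_seq.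
  by apply: DS; apply: XD; move: pF; rewrite in_fset_set// inE.
rewrite big_allpairs exchange_big/=.
apply: (@le_trans _ _ (\sum_(x <- S) M * (q ^+ n0 / (1 - q)))).
  apply: ler_sum => x _; rewrite /u/= -mulr_sumr ler_wpM2l//.
  exact: (geometric_tail_le n0 n1 q01).
by rewrite big_const_seq count_predT iter_addr_0 mulr_natl.
Qed.

End GeometricTails.

(** * Finiteness of the spectrum in gaps *)

Section FrameTails.
Variables (R : realType) (H : completeNormedModType R[i]).
Variables (ip : {dot H for conjC}) (Hip : hilbert_form ip).

Lemma rnorm_ipZr g (a : R[i]) v : rnorm (ip g (a *: v)) = rnorm a * rnorm (ip g v).
Proof.
rewrite linearZr_LR/= rnormM; congr (_ * _).
by rewrite /rnorm norm_conjC.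
Qed.

(** The Bessel inequality tested on the frame vector itself. *)
Lemma frame_upper_bound (I : choiceType) (D : set I) (v : I -> H) :
  is_frame ip D v -> exists2 C : R, 0 < C & forall i, D i -> rnorm (v i) ^+ 2 <= C.
Proof.
move=> [_ [B [C [_ C0 fr]]]]; exists C => // i Di.
have [->|v0] := eqVneq (v i) 0; first by rewrite rnorm0 expr0n ltW.
have /andP[_ up] := fr (v i).
have : ((rnorm (ip (v i) (v i)) ^+ 2)%:E <= (C * rnorm (v i) ^+ 2)%:E)%E.
  apply: le_trans up; apply: esum_ge; exists [set i]; last by rewrite fsbig_set1.
  by split => // _ ->.
rewrite lee_fin Hip rnormX.
have -> : rnorm `|v i| = rnorm (v i) by rewrite norm_rnorm rnormC// rnorm_ge0.
have v2 : 0 < rnorm (v i) ^+ 2 by rewrite exprn_gt0 ?rnorm_gt0.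
by rewrite expr2 ler_pM2r.
Qed.

(** Beyond a large index the whole tail of the frame sum carries less than the
    lower frame constant; finitely many vectors remain, and a large enough
    independent family has a combination orthogonal to all of them. *)
Lemma frame_geometric_tail (T : choiceType) (S : {fset T}) (D : set (nat * T))
    (v : nat * T -> H) (M q : R) :
  is_frame ip D v -> (forall p, D p -> p.2 \in S) -> 0 <= M -> 0 <= q < 1 ->
  ~ (forall m, exists2 e : 'I_m -> H, free_family e &
       forall (a : 'I_m -> R[i]) p, D p ->
         rnorm (ip (\sum_(i < m) a i *: e i) (v p)) ^+ 2 <=
         M * q ^+ p.1 * rnorm (\sum_(i < m) a i *: e i) ^+ 2).
Proof.
move=> [_ [B [C [B0 _ fr]]]] DS M0 q01 large.
have q1 : 0 < 1 - q by rewrite subr_gt0; case/andP: q01.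
(* The added 1 keeps [W] positive when [M] is zero. *)
pose W := #|` S|%:R * M / (1 - q) + 1.
have W0 : 0 < W by rewrite ltr_wpDl// mulr_ge0 ?mulr_ge0// invr_ge0 ltW.
have [n0 qn0] := exists_expr_lt q01 (divr_gt0 B0 W0).
pose s := [seq (n, x) | n <- iota 0 n0, x <- enum_fset S].
have [e fe ev] := large (size s).+1.
pose w (j : 'I_(size s)) := v (tnth (in_tuple s) j).
have [a [g0 gw]] := free_orthogonal_combination ip w (ltnSn _) fe.
set g := \sum_(i < _) _ in g0 gw.
have {}ev p : D p -> rnorm (ip g (v p)) ^+ 2 <= M * q ^+ p.1 * rnorm g ^+ 2.
  exact: ev.
have g2 : 0 < rnorm g ^+ 2 by rewrite exprn_gt0 ?rnorm_gt0.
have /andP[+ _] := fr g; apply/negP; rewrite -ltNge.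
apply: (@le_lt_trans _ _ (#|` S|%:R * (M * rnorm g ^+ 2 * (q ^+ n0 / (1 - q))))%:E).
  apply: esum_geometric_tail_le => //; first by rewrite mulr_ge0 ?sqr_ge0.
  move=> p Dp; case: leqP => n0p; first by rewrite mulrAC; exact: ev.
  have ps : p \in s.
    apply/allpairsP; exists p; split; [|exact: DS|by case: (p)].
    by rewrite mem_iota.
  have [j pj] : exists j, p = tnth (in_tuple s) j by apply/tnthP.
  by rewrite pj -/(w j) gw rnorm0 expr0n mulr0.
rewrite lte_fin.
have -> : #|` S|%:R * (M * rnorm g ^+ 2 * (q ^+ n0 / (1 - q))) =
    (#|` S|%:R * M / (1 - q)) * q ^+ n0 * rnorm g ^+ 2.
  by field; rewrite gt_eqF.
rewrite ltr_pM2r//.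
have qn : 0 <= q ^+ n0 by rewrite exprn_ge0//; case/andP: q01.
apply: (@le_lt_trans _ _ (W * q ^+ n0)).
  by rewrite ler_wpM2r// /W lerDl.
by rewrite mulrC -ltr_pdivlMr.
Qed.

End FrameTails.

Lemma positive_lower_bound (R : realType) (T : eqType) (f : T -> R) (s : seq T) :
  exists2 d, 0 < d & forall v, v \in s -> 0 < f v -> d <= f v.
Proof.
elim: s => [|v s [d d0 ds]]; first by exists 1.
have [v0|v0] := ltP 0 (f v); last first.
  exists d => // w; rewrite inE => /orP[/eqP -> /lt_le_trans/(_ v0)|/ds//].
  by rewrite ltxx.
exists (Num.min d (f v)); first by rewrite lt_min d0.
move=> w; rewrite inE => /orP[/eqP ->|/ds dw] w0.
  by rewrite ge_min lexx orbT.
by rewrite ge_min dw.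
Qed.

Section SpectralGaps.
Variables (R : realType) (H : completeNormedModType R[i]).
Variables (ip : {dot H for conjC}) (Hip : hilbert_form ip).
Variable A : {linear H -> H}.
Variable mu : multiplicity -> {finite_measure set (borelC R) -> \bar R}.
Variables (E : multiplicity -> set (borelC R)) (U : H -> rep R).
Hypothesis HU : spectral_representation mu A E U.
Variables (S : {fset H}) (J : H -> set nat) (c : nat -> H -> R[i]).
Hypothesis Hframe : is_frame ip
     [set p : nat * H | p.2 \in S /\ J p.2 p.1]
     (fun p => c p.1 p.2 *: iter p.1 A p.2).

Let Uunit := sr_unitary HU.
Let Umult := sr_mult HU.
Let Ecarr := sr_singular HU.

Definition geometric_decay (K : set R[i]) (x : H) (M q : R) : Prop :=
  forall n g, J x n -> lives_on mu U K g ->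
    rnorm (ip g (c n x *: iter n A x)) ^+ 2 <= M * q ^+ n * rnorm g ^+ 2.

(** Vectors of [S] whose orbit leaves the region [K] behind: because the orbit
    starts and stays off [K], dies at once, or grows faster than any vector
    living on [K]. *)
Definition escapes (K : set R[i]) (x : H) : Prop :=
  [\/ A x = 0, lives_on mu U (~` K) x |
      exists b : R, [/\ 0 <= b, K `<=` [set z : R[i] | rnorm z <= b] &
                       (b%:E < supp_radius mu E (U x))%E]].

Lemma iter_eq0 x n : A x = 0 -> iter n.+1 A x = 0.
Proof. by move=> Ax; elim: n => [//|n IH]; rewrite iterS IH linear0. Qed.

(** In the third case pick [a] strictly between [b] and the radius: the frame
    bound forces [|c_(n,x)|] below a multiple of [a^-n], against a factor [b^n]
    for the inner product with a vector living on [K]. *)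
Lemma escapes_geometric_decay (K : set (borelC R)) x : measurable K ->
  x \in S -> escapes K x ->
  exists2 M, 0 <= M & exists2 q, 0 <= q < 1 & geometric_decay K x M q.
Proof.
move=> mK xS [Ax|Kx|[b [b0 Kb bx]]].
- exists ((rnorm (c 0%N x) * rnorm x) ^+ 2); first exact: sqr_ge0.
  exists 0; rewrite ?lexx ?ltr01// => -[|n] g _ _.
    rewrite expr0 mulr1 -exprMn lerXn2r ?nnegrE ?mulr_ge0 ?rnorm_ge0//.
    rewrite rnorm_ipZr -mulrA ler_wpM2l ?rnorm_ge0// [leRHS]mulrC.
    exact: CauchySchwarz_rnorm.
  rewrite iter_eq0// scaler0 linear0r rnorm0 expr0n/=.
  by rewrite [0 ^+ _]exprS mul0r mulr0 mul0r.
- exists 0 => //; exists 0; rewrite ?lexx ?ltr01// => n g _ Kg.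
  rewrite (lives_on_disjoint Hip Uunit (setICr K) Kg) ?rnorm0 ?expr0n/= ?mul0r//.
  by apply: (lives_onZ Uunit); exact: (lives_on_iter Umult).
have [C C0 CB] := frame_upper_bound Hip Hframe.
have [a ba ax] : exists2 a, b < a & (a%:E < supp_radius mu E (U x))%E.
  case: (supp_radius mu E (U x)) bx => [r| |//].
    rewrite lte_fin => br; exists ((b + r) / 2); rewrite ?lte_fin; lra.
  by move=> _; exists (b + 1); rewrite ?ltry// ltrDl.
have a0 : 0 < a by exact: le_lt_trans ba.
have nxa : ~ lives_on mu U [set z : R[i] | rnorm z <= a] x.
  by move=> /(supp_radius_le U Ecarr); rewrite leNgt ax.
have [y y0 yx] := iter_lower_bound Uunit Umult (ltW a0) nxa.
have ny : 0 < rnorm y by rewrite rnorm_gt0.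
exists (C * rnorm x ^+ 2 / rnorm y ^+ 2).
  by rewrite divr_ge0 ?sqr_ge0// mulr_ge0 ?sqr_ge0 ?ltW.
exists ((b / a) ^+ 2).
  rewrite sqr_ge0/= expr_lt1//; last by rewrite divr_ge0// ltW.
  by rewrite ltr_pdivrMr// mul1r.
move=> n g Jn Kg; rewrite rnorm_ipZr exprMn.
have cn : rnorm (c n x) ^+ 2 <= C / (a ^+ n * rnorm y) ^+ 2.
  have any : 0 < a ^+ n * rnorm y by rewrite mulr_gt0 ?exprn_gt0.
  rewrite ler_pdivlMr ?exprn_gt0//.
  apply: le_trans (CB (n, x) (conj xS Jn)); rewrite /= rnormZ [leRHS]exprMn.
  rewrite ler_wpM2l ?sqr_ge0// lerXn2r ?nnegrE ?rnorm_ge0 ?(ltW any)//.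
  by have /andP[/le_trans] := yx n; apply.
have ipn : rnorm (ip g (iter n A x)) ^+ 2 <= (b ^+ n * rnorm g * rnorm x) ^+ 2.
  rewrite lerXn2r ?nnegrE ?rnorm_ge0 ?mulr_ge0 ?exprn_ge0 ?rnorm_ge0//.
  exact: (ip_iter_upper_bound Hip Uunit Umult _ _ mK b0 Kb Kg).
apply: le_trans (ler_pM _ _ cn ipn) _; rewrite ?sqr_ge0//.
rewrite le_eqVlt; apply/orP; left; apply/eqP.
rewrite -exprM mulnC exprM expr_div_n.
have an : a ^+ n != 0 by rewrite gt_eqF ?exprn_gt0.
by move: (a ^+ n) (b ^+ n) an => s t s0; field; rewrite s0 gt_eqF.
Qed.

Lemma uniform_geometric_decay (K : set (borelC R)) : measurable K ->
  (forall x, x \in S -> escapes K x) ->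
  exists2 M, 0 <= M & exists2 q, 0 <= q < 1 &
    forall x, x \in S -> geometric_decay K x M q.
Proof.
move=> mK esc.
suff [M M0 [q q01 h]] : exists2 M, 0 <= M & exists2 q, 0 <= q < 1 &
    forall x, x \in enum_fset S -> geometric_decay K x M q.
  by exists M => //; exists q.
have : {subset enum_fset S <= S} by [].
elim: (enum_fset S) => [_|x s IH sS].
  by exists 0 => //; exists 0; rewrite ?lexx ?ltr01.
have [M1 M10 [q1 q11 h1]] := escapes_geometric_decay mK
  (sS _ (mem_head _ _)) (esc _ (sS _ (mem_head _ _))).
have [|M2 M20 [q2 q21 h2]] := IH; first by move=> y ys; apply: sS; rewrite inE ys orbT.
have [q10 q1l] := andP q11; have [q20 q2l] := andP q21.
exists (Num.max M1 M2); first by rewrite le_max M10.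
exists (Num.max q1 q2); first by rewrite le_max q10 gt_max q1l.
have bound n g M q : 0 <= M -> 0 <= q -> M <= Num.max M1 M2 -> q <= Num.max q1 q2 ->
    M * q ^+ n * rnorm (g : H) ^+ 2 <=
    Num.max M1 M2 * Num.max q1 q2 ^+ n * rnorm g ^+ 2.
  move=> M0 q0 Mm qm; rewrite ler_wpM2r ?sqr_ge0// ler_pM ?exprn_ge0//.
  by rewrite lerXn2r ?nnegrE ?(le_trans q0).
move=> y; rewrite inE => /orP[/eqP ->|ys] n g Jn Kg.
  by apply: le_trans (h1 n g Jn Kg) (bound _ _ _ _ _ _ _ _); rewrite // le_max lexx.
apply: le_trans (h2 y ys n g Jn Kg) (bound _ _ _ _ _ _ _ _) => //.
  by rewrite le_max lexx orbT.
by rewrite le_max lexx orbT.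
Qed.

Lemma separation (s : seq R[i]) (e : R) : 0 < e -> uniq s ->
  exists2 d, 0 < d <= e &
    forall l l', l \in s -> l' \in s -> l != l' -> 2 * d <= rnorm (l - l').
Proof.
move=> e0 us; pose f (p : R[i] * R[i]) := rnorm (p.1 - p.2).
have [d d0 ds] := positive_lower_bound f [seq (l, l') | l <- s, l' <- s].
exists (Num.min e (d / 2)); first by rewrite lt_min e0 divr_gt0//= ge_min lexx.
move=> l l' ls l's ll'; apply: le_trans (ds (l, l') _ _).
- by rewrite mulrC -ler_pdivlMr// ge_min lexx orbT.
- by apply/allpairsP; exists (l, l').
- by rewrite rnorm_gt0 subr_eq0.
Qed.

(** Infinitely many spectral values inside [K] would produce arbitrarily large
    orthogonal families living on [K], which the frame does not allow. *)
Lemma finite_spectrum_in_gap (K : set (borelC R)) (L : set R[i]) (e : R) :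
  measurable K -> (forall x, x \in S -> escapes K x) -> 0 < e ->
  (forall l z, L l -> rnorm (l - z) < e -> K z) ->
  finite_set (spectrum A `&` L).
Proof.
move=> mK esc e0 LK; apply: contrapT => infL.
have [M M0 [q q01 dec]] := uniform_geometric_decay mK esc.
apply: (frame_geometric_tail Hframe _ M0 q01 (S := S)) => [p []//|m].
have [X XL mX] := infinite_set_fset m infL.
have [d /andP[d0 de] sep] := separation e0 (fset_uniq X).
pose l (i : 'I_m) := nth 0 (enum_fset X) i.
have lX i : l i \in enum_fset X by rewrite mem_nth// (leq_trans (ltn_ord i)).
have lL i : (spectrum A `&` L) (l i) by apply: XL; exact: lX.
have /choice[f fP] : forall i, exists x : H,
    x != 0 /\ lives_on mu U [set z : R[i] | rnorm (l i - z) < d] x.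
  move=> i; have [x] := spectrum_lives_on Uunit Umult d0 (lL i).1.
  by exists x.
exists f.
  apply: (orthogonal_free Hip) => [i|i j ij]; first by case: (fP i).
  apply: (lives_on_disjoint Hip Uunit _ (fP i).2 (fP j).2).
  apply/seteqP; split => // z /= [zi zj].
  have lij : l i != l j.
    rewrite nth_uniq ?fset_uniq ?(leq_trans (ltn_ord _))//.
  have := sep _ _ (lX i) (lX j) lij; apply/negP; rewrite -ltNge.
  have := rnormD (l i - z) (z - l j); rewrite addrA subrK [rnorm (z - _)]rnormB; lra.
move=> a p [pS Jp]; apply: dec => //.
apply: (lives_on_sum Uunit) => i; apply: lives_onS (fP i).2 => z /= zi.
by apply: (LK (l i)); [exact: (lL i).2|exact: lt_le_trans de].
Qed.

End SpectralGaps.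

(** * Radii of the frame generators *)

Section OperatorNorm.
Variables (R : realType) (H : completeNormedModType R[i]).
Variables (A : {linear H -> H}) (Abnd : bounded_op A).

Lemma opnorm_ub x : rnorm x <= 1 -> rnorm (A x) <= opnorm A.
Proof.
move=> x1; have [M AM] := Abnd; apply: ub_le_sup; last by exists x.
exists `|M| => _ [y /= y1 <-]; apply: le_trans (AM y) _.
apply: le_trans (ler_wpM2r (rnorm_ge0 y) (ler_norm M)) _.
by rewrite -[leRHS]mulr1 ler_wpM2l.
Qed.

Lemma opnorm_ge0 : 0 <= opnorm A.
Proof.
apply: le_trans (rnorm_ge0 (A 0)) (opnorm_ub _).
by rewrite rnorm0 ler01.
Qed.

Lemma le_opnorm x : rnorm (A x) <= opnorm A * rnorm x.
Proof.
have [->|x0] := eqVneq x 0; first by rewrite linear0 !rnorm0 mulr0.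
have nx : 0 < rnorm x by rewrite rnorm_gt0.
have nx' : 0 <= (rnorm x)^-1 by rewrite invr_ge0 ltW.
rewrite -ler_pdivrMr// mulrC -{1}(rnormC nx') -rnormZ -linearZ/=.
by apply: opnorm_ub; rewrite rnormZ rnormC// mulVf// gt_eqF.
Qed.

End OperatorNorm.

Section Radii.
Variables (R : realType) (H : completeNormedModType R[i]).
Variables (ip : {dot H for conjC}) (Hip : hilbert_form ip).
Variables (A : {linear H -> H}) (Abnd : bounded_op A).
Variable mu : multiplicity -> {finite_measure set (borelC R) -> \bar R}.
Variables (E : multiplicity -> set (borelC R)) (U : H -> rep R).
Hypothesis HU : spectral_representation mu A E U.

(** On vectors living where [|z| > a], the operator expands norms by a factor
    of at least [a], so [a] cannot exceed the operator norm. *)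
Lemma supp_radius_opnorm x : (supp_radius mu E (U x) <= (opnorm A)%:E)%E.
Proof.
apply/lee_addgt0Pr => e e0; rewrite -EFinD.
apply/(supp_radius_le U (sr_singular HU)); apply: contrapT => far.
have op0 : 0 <= opnorm A + e by rewrite addr_ge0 ?opnorm_ge0 ?ltW.
have [y y0 yx] := iter_lower_bound (sr_unitary HU) (sr_mult HU) op0 far.
have /andP[+ _] := yx 1%N; rewrite expr1/=; apply/negP; rewrite -ltNge.
apply: le_lt_trans (le_opnorm Abnd y) _.
by rewrite ltr_pM2r ?rnorm_gt0// ltrDl.
Qed.

Lemma supp_radius_gt0 x : A x != 0 -> (0 < supp_radius mu E (U x))%E.
Proof.
apply: contraNT; rewrite -leNgt => /(supp_radius_le U (sr_singular HU)) x0.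
by apply/eqP; exact: (lives_on_zero (sr_unitary HU) (sr_mult HU)).
Qed.

Definition radius x : R := fine (supp_radius mu E (U x)).

Lemma radiusE x : A x != 0 -> supp_radius mu E (U x) = (radius x)%:E.
Proof.
move=> Ax; rewrite /radius fineK// fin_numElt.
rewrite (lt_trans (ltNyr 0) (supp_radius_gt0 Ax))/=.
exact: le_lt_trans (supp_radius_opnorm x) (ltry _).
Qed.

Lemma radius_bounds x : A x != 0 -> 0 < radius x <= opnorm A.
Proof.
move=> Ax; have := supp_radius_gt0 Ax; have := supp_radius_opnorm x.
by rewrite (radiusE Ax) lee_fin lte_fin => -> ->.
Qed.

Variables (S : {fset H}) (J : H -> set nat) (c : nat -> H -> R[i]).
Hypothesis Hframe : is_frame ip
     [set p : nat * H | p.2 \in S /\ J p.2 p.1]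
     (fun p => c p.1 p.2 *: iter p.1 A p.2).

(** The region [s < |z| <= t - e/2] leaves a margin of [e/2] around the closed
    annulus, and the half-open shape makes it disjoint from the disc of radius
    [s] and strictly inside the one of radius [t]. *)
Lemma finite_spectrum_in_annulus (s t e : R) : 0 < e ->
  (forall x, x \in S -> A x != 0 -> radius x <= s \/ t <= radius x) ->
  finite_set (spectrum A `&` [set z : R[i] | s + e <= rnorm z <= t - e]).
Proof.
move=> e0 Sr.
pose K : set (borelC R) := ~` [set z : R[i] | rnorm z <= s] `&`
                           [set z : R[i] | rnorm z <= t - e / 2].
have mK : measurable K.
  apply: measurableI; last exact: measurable_disc_le.
  exact: measurableC (measurable_disc_le s).
apply: (finite_spectrum_in_gap Hip HU Hframe mK _ (e := e / 2)).
- move=> x xS; have [Ax|Ax] := eqVneq (A x) 0; first exact: Or31.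
  have [rs|tr] := Sr x xS Ax.
    apply: Or32; apply: (@lives_onS _ _ _ _ [set z : R[i] | rnorm z <= s]).
      by move=> z zs [].
    by apply/(supp_radius_le U (sr_singular HU)); rewrite radiusE.
  apply: Or33; exists (Num.max 0 (t - e / 2)); split.
  + by rewrite le_max lexx.
  + by move=> z [_ zt]; rewrite /= le_max zt orbT.
  + have /andP[r0 _] := radius_bounds Ax.
    by rewrite radiusE// lte_fin gt_max r0 (lt_le_trans _ tr)// gtrBl divr_gt0.
- by rewrite divr_gt0.
move=> l z /= /andP[sl lt] lz; split=> /=.
  apply/negP; rewrite -ltNge; have := ler_rnormB l z; lra.
have := ler_rnormB z l; rewrite rnormB; lra.
Qed.

(** If [A] killed all of [S], every orbit would escape the whole plane and the
    frame would consist of finitely many nonzero vectors. *)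
Lemma exists_nonzero_image : infinite_dimensional H -> exists2 x, x \in S & A x != 0.
Proof.
move=> Hinf; apply: contrapT => S0.
have esc x : x \in S -> escapes A mu E U setT x.
  move=> xS; apply: Or31; apply: contrapT => /eqP Ax.
  by apply: S0; exists x.
have [M M0 [q q01 dec]] := uniform_geometric_decay Hip HU Hframe measurableT esc.
apply: (frame_geometric_tail Hframe _ M0 q01 (S := S)) => [p []//|m].
have [f ff] := infinite_dimensional_free m Hinf; exists f => // a p [pS Jp].
by apply: dec => //; apply: ae_coordW => p' z /(_ I).
Qed.

Lemma isolated_not_continuous (l : R[i]) (K : set R[i]) :
  nbhs (l : R[i]^o) K -> finite_set (spectrum A `&` K) -> ~ continuous_spectrum A l.
Proof.
move=> /nbhs_rnorm[e e0 eK] finK [Al inj _ _].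
have [d d0 dP] := positive_lower_bound (fun z => rnorm (l - z))
  (fset_set (spectrum A `&` K)).
have ed : 0 < Num.min e d by rewrite lt_min e0.
apply: (isolated_eigenvalue (sr_unitary HU) (sr_mult HU) (sr_spectrum HU) ed Al) => //.
move=> z Az; rewrite lt_min => /andP[ze zd]; apply/eqP/negPn/negP => zl.
have : d <= rnorm (l - z).
  apply: dP; last by rewrite rnorm_gt0 subr_eq0 eq_sym.
  by rewrite in_fset_set// inE; split => //; exact: eK.
by rewrite leNgt zd.
Qed.

End Radii.

Lemma cdisc_le (R : realType) (a : R) : cdisc a `<=` [set z : R[i] | rnorm z <= a].
Proof.
move=> z za /=; apply/ler_addgt0Pr => e e0.
have [w [wa zw]] := za _ (near_rnorm z e0).
have := ler_rnormB z w; move: wa zw; rewrite /disc/=; lra.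
Qed.

Theorem theorem3p6
  (R : realType) (H : completeNormedModType R[i])
  (ip : {dot H for conjC}) (Hip : hilbert_form ip)
  (Hsep : separable_space H) (Hinf : infinite_dimensional H)
  (A : {linear H -> H}) (Abnd : bounded_op A) (Anormal : normal_op ip A)
  (mu : multiplicity -> {finite_measure set (borelC R) -> \bar R})
  (E : multiplicity -> set (borelC R)) (U : H -> rep R)
  (HU : spectral_representation mu A E U)
  (S : {fset H}) (J : H -> set nat) (c : nat -> H -> R[i])
  (c_neq0 : forall x n, x \in S -> J x n -> c n x != 0)
  (Hframe : is_frame ip
     [set p : nat * H | p.2 \in S /\ J p.2 p.1]
     (fun p => c p.1 p.2 *: iter p.1 A p.2))
  (Hsynd : exists (eta : nat) (delta : R), [/\ (0 < eta)%N, 0 < delta &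
     forall x, x \in S -> infinite_set (J x) ->
       exists (n i : nat -> nat),
         [/\ forall k, (n k < n k.+1)%N,
             syndetic (fun k => (n k)%:Z),
             forall k, J x (n k),
             forall k, `|(i k)%:Z - (n k)%:Z| <= eta%:Z &
             forall k, delta <= rnorm (c (n k) x) * rnorm (iter (i k) A x)]]) :
  exists (N : nat) (r : nat -> R),
    [/\ (0 < N <= #|` [fset x in S | A x != 0%R]%fset|)%N,
        (forall i j, (i < j < N)%N -> r i < r j),
        (forall i, (i < N)%N -> 0 < r i <= opnorm A),
        (forall i, (i < N)%N ->
           exists2 x, x \in S & supp_radius mu E (U x) = (r i)%:E) /\
        continuous_spectrum A `<=`
          \bigcup_(i in [set i | (i < N)%N]) [set z | rnorm z = r i] &
        \forall e \near 0^'+,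
          finite_set (spectrum A `&`
            (cdisc (r 0%N - e) `|`
             \bigcup_(i in [set i | (0 < i < N)%N])
               (cdisc (r i - e) `\` disc (r i.-1 + e))))].
Proof.
have isE := radiusE Abnd HU; have isb := radius_bounds Abnd HU.
pose S' := [fset x in S | A x != 0%R]%fset.
pose rad := radius mu E U.
pose s := sort <=%O (undup [seq rad x | x <- enum_fset S']).
have S'P x : (x \in S') = (x \in S) && (A x != 0) by rewrite !inE.
have sP v : v \in s -> exists2 x, x \in S' & v = rad x.
  by rewrite mem_sort mem_undup => /mapP.
have Ss x : x \in S -> A x != 0 -> rad x \in s.
  move=> xS Ax; rewrite mem_sort mem_undup; apply/mapP; exists x => //.
  by rewrite S'P xS.
have s_lt : sorted <%O s.
  by rewrite lt_sorted_uniq_le sort_uniq undup_uniq (sort_sorted le_total).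
pose r i := nth 0 s i.
have rS i : (i < size s)%N -> exists2 x, (x \in S) && (A x != 0) & r i = rad x.
  by move=> iN; have [x xS' rx] := sP _ (mem_nth 0 iN); exists x; rewrite -?S'P.
have r_lt i j : (i < j < size s)%N -> r i < r j.
  by move=> /andP[ij jN]; apply: (sorted_ltn_nth lt_trans) => //; rewrite inE ?(ltn_trans ij).
have r_le i j : (i <= j < size s)%N -> r i <= r j.
  move=> /andP[]; rewrite leq_eqVlt => /orP[/eqP ->//|ij jN].
  by apply/ltW/r_lt; rewrite ij.
have Sr x : x \in S -> A x != 0 -> exists2 j, (j < size s)%N & rad x = r j.
  move=> xS Ax; exists (index (rad x) s); first by rewrite index_mem Ss.
  by rewrite /r nth_index ?Ss.
have N0 : (0 < size s)%N.
  have [x xS Ax] := exists_nonzero_image Hip HU Hframe Hinf.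
  by have [j /(leq_ltn_trans (leq0n j))] := Sr x xS Ax.
exists (size s), r; split.
- by rewrite N0/= size_sort (leq_trans (size_undup _))// size_map.
- exact: r_lt.
- by move=> i /rS[x /andP[_ Ax] ->]; exact: isb.
- split=> [i /rS[x /andP[xS Ax] ->]|l Al].
    by exists x => //; exact: isE.
  apply: contrapT => offl.
  have [d d0 dP] := positive_lower_bound (fun v => `|v - rnorm l|) s.
  have d2 : 0 < d / 2 by rewrite divr_gt0.
  apply: (@isolated_not_continuous _ _ _ _ _ _ HU l
    [set z : R[i] | rnorm l - d + d / 2 <= rnorm z <= rnorm l + d - d / 2]) Al.
    apply: filterS (near_rnorm l d2) => z /= lz.
    have := ler_rnormB l z; have := ler_rnormB z l; rewrite [rnorm (z - l)]rnormB.
    by move=> ? ?; apply/andP; split; lra.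
  apply: (finite_spectrum_in_annulus Hip Abnd HU Hframe) => // x xS Ax.
  have := dP _ (Ss x xS Ax); rewrite normr_gt0 subr_eq0 => h.
  have /h : rad x != rnorm l.
    apply/eqP => rl; apply: offl; have [j jN rj] := Sr x xS Ax.
    by exists j => //=; rewrite -rj.
  by rewrite ler_normr => /orP[|]; [right|left]; rewrite -/rad; lra.
near=> e.
have e0 : 0 < e by [].
rewrite setIUr setI_bigcupr finite_setU; split.
  apply: sub_finite_set (@finite_spectrum_in_annulus _ _ _ Hip _ Abnd _ _ _ HU
    _ _ _ Hframe (- e) (r 0%N) e e0 _) => [z [Az /cdisc_le/= ze]|x xS Ax].
    by split => //=; rewrite addNr rnorm_ge0.
  by right; have [j jN rj] := Sr x xS Ax; rewrite -/(rad x) rj; apply: r_le.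
apply: bigcup_finite => [|i /= /andP[i0 iN]].
  by apply: sub_finite_set (finite_II (size s)) => i /= /andP[].
apply: sub_finite_set (@finite_spectrum_in_annulus _ _ _ Hip _ Abnd _ _ _ HU
    _ _ _ Hframe (r i.-1) (r i) e e0 _) => [z [Az [/cdisc_le/= ze]]|x xS Ax].
  by rewrite /disc/= => /negP; rewrite -leNgt => ez; split => //=; rewrite ez.
have [j jN rj] := Sr x xS Ax; rewrite -/(rad x) rj; have [ij|ji] := leqP i j.
  by right; apply: r_le; rewrite ij.
left; apply: r_le; rewrite -ltnS prednK// ji/=.
exact: ltnW.
Unshelve. all: by end_near.
Qed.
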